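(* Let $G$ and $H$ be snarks with Hists $T_G$ and $T_H$ respectively. Then: (1) there is a snark $G'$ with a Hist $T'$ such that $oc(G',T')=oc(G,T_G)\cup oc(H,T_H)$ (multiset union); (2) if $k\in oc(G,T_G)$ and $l\in oc(H,T_H)$, then there is a snark $\hat G$ with a Hist $\hat T$ such that $oc(\hat G,\hat T)$ is the multiset obtained from $oc(G,T_G)\cup oc(H,T_H)$ by removing one copy of $k$ and one copy of $l$ and adding one copy of $k+l-1$.
   Context: A snark is a cyclically $4$-edge-connected cubic (3-regular) graph of girth at least $5$ that admits no proper $3$-edge-colouring. A Hist of a cubic graph $G$ is a spanning tree $T$ of $G$ with no vertex of degree two (so every vertex of $T$ has degree $1$ or $3$). Given a Hist $T$ of a cubic graph $G$, the edges of $G$ not in $T$ form vertex-disjoint cycles whose vertices are exactly the leaves of $T$; these are the outer cycles of $(G,T)$. If $C_1,\dots,C_k$ are all outer cycles, $oc(G,T)$ denotes the multiset $\{|V(C_1)|,\dots,|V(C_k)|\}$ of their lengths. *)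

(* Defs.v *)
From mathcomp Require Import all_boot.
Set Implicit Arguments. Unset Strict Implicit. Unset Printing Implicit Defensive.

Section Graphs.
Variable V : finType.

Definition simple_graph (adj : rel V) : Prop :=
  symmetric adj /\ irreflexive adj.

Definition deg (adj : rel V) (v : V) : nat := #|[set w | adj v w]|.

Definition cubic (adj : rel V) : Prop :=
  simple_graph adj /\ forall v, deg adj v = 3.

Definition is_cycle (adj : rel V) (p : seq V) : Prop :=
  [/\ uniq p, 3 <= size p & cycle adj p].

Definition girth_ge5 (adj : rel V) : Prop :=
  forall p, is_cycle adj p -> 5 <= size p.

Definition cut_size (adj : rel V) (S : {set V}) : nat :=
  #|[set x : V * V | [&& adj x.1 x.2, x.1 \in S & x.2 \notin S]]|.

Definition has_cycle_in (adj : rel V) (S : {set V}) : Prop :=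
  exists p, is_cycle adj p /\ {subset p <= S}.

Definition cyc4_edge_connected (adj : rel V) : Prop :=
  forall S : {set V}, has_cycle_in adj S -> has_cycle_in adj (~: S) ->
    4 <= cut_size adj S.

Definition three_edge_colourable (adj : rel V) : Prop :=
  exists c : V -> V -> 'I_3,
    (forall u v, c u v = c v u) /\
    (forall u v w, adj u v -> adj u w -> v != w -> c u v != c u w).

Definition snark (adj : rel V) : Prop :=
  [/\ cubic adj, cyc4_edge_connected adj, girth_ge5 adj
    & ~ three_edge_colourable adj].

Definition spanning_tree (adj t : rel V) : Prop :=
  [/\ symmetric t, subrel t adj, (forall x y, connect t x y)
    & forall p, ~ is_cycle t p].

Definition hist (adj t : rel V) : Prop :=
  spanning_tree adj t /\ forall v, deg t v != 2.

Definition cotree (adj t : rel V) : rel V := fun u v => adj u v && ~~ t u v.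

Definition leaf (t : rel V) (v : V) : bool := deg t v == 1.

Definition outer_cycles (adj t : rel V) : {set {set V}} :=
  [set [set y | connect (cotree adj t) x y] | x in [set v | leaf t v]].

(* oc(G,T): multiset (as a sequence up to permutation) of outer cycle lengths *)
Definition oc (adj t : rel V) : seq nat :=
  map (fun C : {set V} => #|C|) (enum (outer_cycles adj t)).

End Graphs.

(* Main.v *)
Require Import Defs.
From mathcomp Require Import all_boot zify.
Set Implicit Arguments. Unset Strict Implicit. Unset Printing Implicit Defensive.

(* Both graphs are variants of the dot product.  Remove independent edges ab, cd of G; in H, let
   x, y be adjacent with N(x) = {y, x1, x2} and N(y) = {x, y1, y2}, and remove x x2, y y1, y y2.
   Add a x, b y, y x2, c y1, d y2: the usual dot product with its edges a x1 and b x2 subdivided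
   and joined by a rung xy.  For (2) choose ab in T_G, cd on the outer cycle of length k, x an
   inner vertex of T_H and y a leaf on the outer cycle of length l: T_H hangs from the subdivided
   edge ab, and the cycles through cd and y merge into one of length k + l - 1.  For (1) choose
   ab and cd in T_G and x, y both inner, and insert a second rung between c y1 and d y2; every
   outer cycle then survives.

   By the parity lemma, a 3-edge-colouring of the result gives distinct colours to the edges
   leaving a and b (otherwise G is colourable) and equal colours to those leaving x1 and x2
   (otherwise H is), which a rung forbids.  Cyclic 4-edge-connectivity is handled in the
   equivalent form: every cut with at least two vertices on both sides has at least four edges.
   A tree is recognised by being connected with degree sum 2(n - 1). *)

(** Edge counts dictate the choices. In (2) the new tree trades [ab] and [x x2] for [ax], [by] and
    [y x2]: one edge more than the two trees together, as a single tree on all their vertices needs.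
    The leaf [y] thereby becomes inner and drops out of its outer cycle, whence the [- 1]. In (1)
    all five deleted edges are tree edges and all five added ones enter the tree, so one edge is
    missing; the second rung supplies it by bringing two vertices and three edges. The second rung
    has a price: the edges it subdivides may carry different colours at their two ends, so a
    colouring of the result is not one of the dot product. The parity argument is therefore made for
    colourings of half-edges with mismatches allowed on named edges. It then serves both graphs and
    can be stated inside [G] and [H] themselves. For cuts, the edges within [H - x - y] are bounded
    by placing [x] and [y] on whichever sides give the best bound in [H], which need not be their
    sides in the product. *)

Ltac neq_tac := rewrite /= !inE !negb_or => H;
  repeat match goal with K : is_true (_ && _) |- _ => case/andP: K => ? ? end;
  do !split; apply/negbTE; rewrite // eq_sym.

(** All equality tests come in one tuple and in both orientations, so that a single [rewrite]
    decides any comparison of named vertices. *)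
Lemma uniq4_neq (T : eqType) (p q r s : T) :
  uniq [:: p; q; r; s] ->
  ((p == q) = false) * ((p == r) = false) * ((p == s) = false) * ((q == p) = false) *
  ((q == r) = false) * ((q == s) = false) * ((r == p) = false) * ((r == q) = false) *
  ((r == s) = false) * ((s == p) = false) * ((s == q) = false) * ((s == r) = false).
Proof. by neq_tac. Qed.

Lemma uniq5_neq (T : eqType) (p q r s t : T) :
  uniq [:: p; q; r; s; t] ->
  ((p == q) = false) * ((p == r) = false) * ((p == s) = false) * ((p == t) = false) *
  ((q == p) = false) * ((q == r) = false) * ((q == s) = false) * ((q == t) = false) *
  ((r == p) = false) * ((r == q) = false) * ((r == s) = false) * ((r == t) = false) *
  ((s == p) = false) * ((s == q) = false) * ((s == r) = false) * ((s == t) = false) *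
  ((t == p) = false) * ((t == q) = false) * ((t == r) = false) * ((t == s) = false).
Proof. by neq_tac. Qed.

Lemma uniq6_neq (T : eqType) (p q r s t u : T) :
  uniq [:: p; q; r; s; t; u] ->
  ((p == q) = false) * ((p == r) = false) * ((p == s) = false) * ((p == t) = false) *
  ((p == u) = false) * ((q == p) = false) * ((q == r) = false) * ((q == s) = false) *
  ((q == t) = false) * ((q == u) = false) * ((r == p) = false) * ((r == q) = false) *
  ((r == s) = false) * ((r == t) = false) * ((r == u) = false) * ((s == p) = false) *
  ((s == q) = false) * ((s == r) = false) * ((s == t) = false) * ((s == u) = false) *
  ((t == p) = false) * ((t == q) = false) * ((t == r) = false) * ((t == s) = false) *
  ((t == u) = false) * ((u == p) = false) * ((u == q) = false) * ((u == r) = false) *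
  ((u == s) = false) * ((u == t) = false).
Proof. by neq_tac. Qed.

(** * Edge insertion and deletion *)

Section EdgeOps.
Variable V : finType.
Implicit Types (e : rel V) (p q u v : V) (S : {set V}).

Definition is_edge p q u v := (u == p) && (v == q) || (u == q) && (v == p).
Definition add_edge p q e : rel V := fun u v => e u v || is_edge p q u v.
Definition del_edge p q e : rel V := fun u v => e u v && ~~ is_edge p q u v.

Lemma is_edgeC p q u v : is_edge p q u v = is_edge p q v u.
Proof. by rewrite /is_edge orbC; congr (_ || _); rewrite andbC. Qed.

Lemma add_edge_sym p q e : symmetric e -> symmetric (add_edge p q e).
Proof. by move=> es u v; rewrite /add_edge es is_edgeC. Qed.

Lemma del_edge_sym p q e : symmetric e -> symmetric (del_edge p q e).
Proof. by move=> es u v; rewrite /del_edge es is_edgeC. Qed.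

Lemma add_edge_irr p q e : p != q -> irreflexive e -> irreflexive (add_edge p q e).
Proof.
move=> npq ei u; rewrite /add_edge ei /is_edge /=.
by apply/negP => /orP [] /andP [/eqP Ep /eqP Eq]; rewrite -Ep -Eq eqxx in npq.
Qed.

Lemma del_edge_irr p q e : irreflexive e -> irreflexive (del_edge p q e).
Proof. by move=> ei u; rewrite /del_edge ei. Qed.

Lemma del_edgeK p q e : symmetric e -> e p q -> add_edge p q (del_edge p q e) =2 e.
Proof.
move=> es epq u v; rewrite /add_edge /del_edge.
have [|] := boolP (is_edge p q u v); rewrite ?andbT ?orbF ?andbF //=.
by case/orP=> /andP [/eqP -> /eqP ->]; rewrite // es.
Qed.

Lemma del_edge_notin p q e : del_edge p q e p q = false.
Proof. by rewrite /del_edge /is_edge !eqxx /= andbF. Qed.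

Lemma degE e v : deg e v = \sum_w (e v w : nat).
Proof. by rewrite /deg -sum1dep_card big_mkcond; apply: eq_bigr => w _; case: (e v w). Qed.

Lemma eq_deg e e' : e =2 e' -> deg e =1 deg e'.
Proof. by move=> ee' v; rewrite !degE; apply: eq_bigr => w _; rewrite ee'. Qed.

Lemma cut_sizeE e S :
  cut_size e S = \sum_u \sum_v ([&& e u v, u \in S & v \notin S] : nat).
Proof.
rewrite /cut_size -sum1dep_card big_mkcond pair_bigA /=.
by apply: eq_bigr => -[u v] _ /=; case: ifP.
Qed.

Lemma eq_cut_size e e' S : e =2 e' -> cut_size e S = cut_size e' S.
Proof. by move=> ee'; congr #|pred_of_set _|; apply/setP => x; rewrite !inE ee'. Qed.

Lemma sum_pt (b : bool) q : \sum_w ((b && (w == q)) : nat) = b.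
Proof.
rewrite (bigD1 q) //= eqxx andbT big1 ?addn0 // => w /negbTE ->.
by rewrite andbF.
Qed.

Lemma sum_pt2 p q (F : V -> V -> bool) :
  \sum_u \sum_v (((u == p) && (v == q) && F u v) : nat) = F p q.
Proof.
rewrite (bigD1 p) //= [X in _ + X]big1 ?addn0 => [|u /negbTE ->]; last first.
  by rewrite big1.
rewrite (bigD1 q) //= [X in _ + X]big1 ?addn0 => [|u /negbTE ->] //=.
  by rewrite !eqxx.
by rewrite andbF.
Qed.

Lemma add_edge_nat p q e u v : p != q -> symmetric e -> ~~ e p q ->
  (add_edge p q e u v : nat) = e u v + ((u == p) && (v == q)) + ((u == q) && (v == p)).
Proof.
move=> npq es nepq; rewrite /add_edge /is_edge.
have [/andP [/eqP -> /eqP ->]|_] := boolP ((u == p) && (v == q)).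
  by rewrite (negbTE nepq) (negbTE npq).
have [/andP [/eqP -> /eqP ->]|_] := boolP ((u == q) && (v == p)).
  by rewrite es (negbTE nepq).
by rewrite !orbF !addn0.
Qed.

Lemma deg_add p q e v : p != q -> symmetric e -> ~~ e p q ->
  deg (add_edge p q e) v = deg e v + (v == p) + (v == q).
Proof.
move=> npq es nepq; rewrite !degE.
rewrite (eq_bigr _ (fun w _ => add_edge_nat v w npq es nepq)) !big_split /=.
by rewrite !sum_pt.
Qed.

Lemma deg_del p q e v : p != q -> symmetric e -> e p q ->
  deg e v = deg (del_edge p q e) v + (v == p) + (v == q).
Proof.
move=> npq es epq; rewrite -deg_add // ?del_edge_notin //; last exact: del_edge_sym.
by apply: eq_deg => u w; rewrite del_edgeK.
Qed.

Lemma cut_add p q e S : p != q -> symmetric e -> ~~ e p q ->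
  cut_size (add_edge p q e) S = cut_size e S + ((p \in S) != (q \in S)).
Proof.
move=> npq es nepq; rewrite !cut_sizeE.
transitivity (\sum_u \sum_v ([&& e u v, u \in S & v \notin S]
  + (((u == p) && (v == q)) && ((u \in S) && (v \notin S)))
  + (((u == q) && (v == p)) && ((u \in S) && (v \notin S))))).
  apply: eq_bigr => u _; apply: eq_bigr => v _.
  have := add_edge_nat u v npq es nepq.
  by case: (add_edge _ _ _ _ _); case: (e u v); case: (u \in S); case: (v \in S);
    do !case: (_ == _).
rewrite (eq_bigr _ (fun u _ => big_split _ _ _ _ _)) big_split /=.
rewrite (eq_bigr _ (fun u _ => big_split _ _ _ _ _)) big_split /=.
rewrite !(sum_pt2 _ _ (fun u v => (u \in S) && (v \notin S))) -addnA; congr (_ + _).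
by case: (p \in S); case: (q \in S).
Qed.

Lemma cut_del p q e S : p != q -> symmetric e -> e p q ->
  cut_size e S = cut_size (del_edge p q e) S + ((p \in S) != (q \in S)).
Proof.
move=> npq es epq; rewrite -cut_add // ?del_edge_notin //; last exact: del_edge_sym.
by apply: eq_cut_size => u w; rewrite del_edgeK.
Qed.

Lemma cut_sizeC e S : symmetric e -> cut_size e (~: S) = cut_size e S.
Proof.
move=> es; rewrite !cut_sizeE exchange_big; apply: eq_bigr => u _; apply: eq_bigr => v _.
by rewrite !inE negbK es; case: (e _ _); case: (u \in S); case: (v \in S).
Qed.

(** Ordered pairs: every edge inside [S] counts twice, once for each end. *)
Definition inner e S := \sum_(u in S) \sum_(v in S) (e u v : nat).

Lemma innerU1 e S v : symmetric e -> irreflexive e -> v \notin S ->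
  inner e (v |: S) = inner e S + (\sum_(w in S) (e v w : nat)).*2.
Proof.
move=> es ei vS; rewrite /inner big_setU1 //= big_setU1 //= ei add0n.
under [X in _ + X]eq_bigr => u _ do rewrite big_setU1 //=.
rewrite big_split /= [X in _ + (X + _)](eq_bigr (fun w => (e v w : nat))); last by move=> w _; rewrite es.
by rewrite -addnn; lia.
Qed.

Lemma inner0 e : inner e set0 = 0.
Proof. by rewrite /inner big_set0. Qed.

Lemma inner_even e S : symmetric e -> irreflexive e -> odd (inner e S) = false.
Proof.
move=> es ei; have [n] := ubnP #|S|; elim: n S => // n IH S.
have [->|/set0Pn [v vS]] := eqVneq S set0; first by rewrite inner0.
rewrite -(setD1K vS) cardsU1 setD11 /= => cS.
by rewrite innerU1 ?setD11 // oddD odd_double IH.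
Qed.

Lemma inner_setT e : inner e setT = \sum_u deg e u.
Proof.
rewrite /inner; apply: eq_big => [u|u _]; rewrite ?inE // degE.
by apply: eq_bigl => v; rewrite inE.
Qed.

Lemma sum_deg_inner e S : \sum_(u in S) deg e u = inner e S + cut_size e S.
Proof.
rewrite cut_sizeE [X in _ = _ + X](bigID (mem S)) /= [X in _ = _ + (_ + X)]big1 ?addn0; last first.
  by move=> u /negbTE uS; rewrite big1 // => v _; rewrite uS /= andbF.
rewrite -big_split; apply: eq_bigr => u uS /=.
rewrite degE (bigID (mem S)) /=; congr (_ + _).
by rewrite big_mkcond /=; apply: eq_bigr => v _; rewrite uS /=; case: (v \in S); case: (e u v).
Qed.

End EdgeOps.

(** * Cycles, trees and cuts *)

Section Trees.
Variable V : finType.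
Implicit Types (e : rel V) (p q u v : V) (S : {set V}).

(** A path inside [S] is extended at its first vertex [v] to a neighbour other than the second
    vertex. Path lengths are bounded, so at some point that neighbour already lies on the path and
    closes a cycle. *)
Lemma min_deg2_cycle e S v0 : symmetric e -> irreflexive e -> v0 \in S ->
  (forall v, v \in S -> 2 <= \sum_(w in S) (e v w : nat)) -> has_cycle_in e S.
Proof.
move=> es ei v0S dS.
suff H : forall n v (p : seq V), #|V| - size p <= n -> path e v p -> uniq (v :: p) ->
    {subset v :: p <= S} -> has_cycle_in e S.
  by apply: (H _ v0 [::]) => // w; rewrite inE => /eqP ->.
elim=> [|n IH] v p hn pp up ps.
  have /card_uniqP Eu := up.
  by have := max_card (mem (v :: p)); rewrite Eu /=; move: hn; rewrite leqn0 subn_eq0 => h1 h2;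
    have := leq_trans h2 h1; rewrite ltnn.
have vS : v \in S by apply: ps; rewrite inE eqxx.
(* The second vertex of the path. For a one-vertex path the default [v] is harmless, since [v] is
   not its own neighbour. *)
pose h := head v p.
have [w /and3P [wS evw nwh]] : exists w, [&& w \in S, e v w & w != h].
  apply/existsP; apply: contraT; rewrite negb_exists => /forallP Hn.
  have := dS v vS; suff : \sum_(w in S) (e v w : nat) <= \sum_w ((true && (w == h)) : nat).
    by rewrite sum_pt; lia.
  rewrite big_mkcond; apply: leq_sum => w _; have := Hn w.
  by case: (w \in S); case: (e v w); case: (w == h).
have [wp|wp] := boolP (w \in v :: p); last first.
  apply: (IH w (v :: p)).
  - by rewrite [size _]/=; move: hn; clear; lia.
  - by rewrite /= es evw.
  - by rewrite cons_uniq wp -/(uniq (v :: p)) up.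
  - by move=> z; rewrite inE => /predU1P [-> //|]; exact: ps.
move: wp; rewrite inE => /predU1P [E|wp]; first by rewrite E ei in evw.
have : w != head v p by []. clear h nwh hn; case/splitPr: wp pp up ps => p1 p2 pp up ps.
case: p1 pp up ps => [|z p1] pp up ps; first by rewrite /= eqxx.
move=> _; exists (v :: rcons (z :: p1) w); split.
  split.
  - by move: up; rewrite -cat_rcons -cat_cons cat_uniq => /and3P [].
  - by rewrite /= size_rcons.
  - rewrite /cycle rcons_path last_rcons es evw andbT.
    by move: pp; rewrite -cat_rcons cat_path => /andP [].
by move=> y yp; apply: ps; rewrite -cat_rcons -cat_cons mem_cat yp.
Qed.

(** A vertex with at most one neighbour in [S] can be deleted: [inner] drops by at most 2, so the
    inequality survives. If there is none, [min_deg2_cycle] applies. The slack [.+1] costs nothing,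
    [inner] being even, and spares [cyc4_trivial] and [tree_sum] a parity argument. *)
Lemma inner_cycle e S : symmetric e -> irreflexive e -> S != set0 ->
  (#|S|.*2 <= (inner e S).+1) -> has_cycle_in e S.
Proof.
move=> es ei; have [n] := ubnP #|S|; elim: n S => // n IH S cS S0 hS.
have [/existsP [v /andP [vS dv]]|] :=
    boolP [exists v, (v \in S) && (\sum_(w in S) (e v w : nat) <= 1)].
  have dv' : \sum_(w in S :\ v) (e v w : nat) <= 1.
    by move: dv; rewrite (big_setD1 v) //= ei.
  move: hS cS; rewrite -(setD1K vS) innerU1 ?setD11 // cardsU1 setD11 => hS cS.
  have [E|S'0] := eqVneq (S :\ v) set0.
    by move: hS; rewrite E inner0 cards0 big_set0.
  have [p [cp pS]] : has_cycle_in e (S :\ v) by apply: IH => //; lia.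
  by exists p; split=> // z /pS zS; rewrite in_setU1 zS orbT.
rewrite negb_exists => /forallP H.
case/set0Pn: S0 => v0 v0S; apply: (min_deg2_cycle es ei v0S) => v vS.
by have := H v; rewrite vS /= -ltnNge.
Qed.

Lemma connect_stable e S u v : symmetric e -> u \in S ->
  (forall x y, x \in S -> e x y -> y \in S) -> connect e u v -> v \in S.
Proof.
move=> es uS cl cuv.
have cS : closed e S by apply: intro_closed => [|x y exy xS]; [exact: sym_connect_sym|exact: cl exy].
by rewrite -(closed_connect cS cuv).
Qed.

(** A set grows from a single vertex along the edges that leave it. Each new vertex adds at least 2
    to [inner], and a nonempty set that no edge leaves is everything. *)
Lemma connected_inner e : symmetric e -> irreflexive e ->
  (forall x y, connect e x y) -> (#|V|.-1).*2 <= \sum_u deg e u.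
Proof.
move=> es ei ec; have [->//|Vn0] := posnP #|V|.
suff H k : k < #|V| -> exists S, #|S| = k.+1 /\ k.*2 <= inner e S.
  have [|S [cS]] := H #|V|.-1; first by lia.
  have -> : S = setT by apply/eqP; rewrite eqEcard subsetT cardsT cS; lia.
  by rewrite inner_setT.
elim: k => [_|k IH hk].
  by case/card_gt0P: Vn0 => v _; exists [set v]; rewrite cards1.
have [|S [cS iS]] := IH; first by lia.
have [/existsP [u /existsP [v /and3P [uS vS euv]]]|] :=
   boolP [exists u, exists v, [&& u \in S, v \notin S & e u v]].
  exists (v |: S); rewrite cardsU1 vS cS innerU1 //; split=> //.
  have : 1 <= \sum_(w in S) (e v w : nat) by rewrite (bigD1 u) //= es euv.
  by lia.
rewrite negb_exists => /forallP Hn.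
have /card_gt0P [u uS] : 0 < #|S| by rewrite cS.
have ST : S = setT.
  apply/setP => v; rewrite inE; apply: (connect_stable es uS) (ec u v) => x y xS exy.
  have := Hn x; rewrite negb_exists => /forallP /(_ y).
  by rewrite xS exy andbT /= negbK.
by move: cS hk; rewrite ST cardsT; lia.
Qed.

(** Deleting one edge of a cycle keeps the graph connected and lowers the degree sum by 2, below the
    minimum given by [connected_inner]. *)
Lemma acyclic_count e : symmetric e -> irreflexive e -> (forall x y, connect e x y) ->
  \sum_u deg e u <= (#|V|.-1).*2 -> forall p : seq V, ~ is_cycle e p.
Proof.
move=> es ei ec hd [|x0 [|x1 [|y r]]] [up sp cp] //.
have e01 : e x0 x1 by move: cp => /= /andP [].
have n01 : x0 != x1 by move: up; rewrite /= inE negb_or; case: (x0 == x1).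
pose e' := del_edge x0 x1 e.
have es' : symmetric e' by exact: del_edge_sym.
have ei' : irreflexive e' by exact: del_edge_irr.
have c10 : connect e' x1 x0.
  apply/connectP; exists (y :: rcons r x0); last by rewrite /= last_rcons.
  move: cp => /= /and3P [_ exy pr].
  move: up => /= /and3P []; rewrite !inE !negb_or => /and3P [_ nx0y x0r] /andP [nx1y x1r] _.
  apply/andP; split.
    rewrite /e' /del_edge exy /is_edge eqxx [x1 == x0]eq_sym (negbTE n01) /=.
    by rewrite eq_sym (negbTE nx0y).
  (* From [y] on, the path never meets [x1] again and so cannot use the deleted edge. *)
  apply: (@sub_in_path _ (predC1 x1) e) pr => [u v|].
    rewrite !inE /e' /del_edge /is_edge => /negbTE -> /negbTE -> ->.
    by rewrite andbF.
  rewrite /= eq_sym nx1y all_rcons /= n01.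
  by apply/allP => z zr /=; apply: contraNneq x1r => <-.
have ec' u v : connect e' u v.
  apply: connect_sub (ec u v) => {}u {}v euv.
  have [|ne] := boolP (is_edge x0 x1 u v); last by apply: connect1; rewrite /e' /del_edge euv.
  by case/orP => /andP [/eqP -> /eqP ->] //; rewrite (sym_connect_sym es').
have := connected_inner es' ei' ec'.
move: hd; rewrite (eq_bigr _ (fun v _ => deg_del v n01 es e01)) !big_split /=.
have -> : \sum_u ((u == x0) : nat) = 1 by rewrite -[RHS](sum_pt true x0).
by move=> h1 h2; have := leq_trans h1 h2; rewrite -addnA -[X in _ <= X]addn0 leq_add2l.
Qed.

Lemma tree_sum e : symmetric e -> irreflexive e -> (forall x y, connect e x y) ->
  (forall p : seq V, ~ is_cycle e p) -> \sum_u deg e u = (#|V|.-1).*2.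
Proof.
move=> es ei ec ea; apply/eqP; rewrite eqn_leq connected_inner // andbT.
rewrite leqNgt; apply/negP => H.
have [V0|/card_gt0P [v _]] := posnP #|V|.
  by move: H; rewrite big1 // => v; have := card0_eq V0 v; rewrite inE.
have [||p [cp _]] := @inner_cycle e setT es ei; last exact: ea cp.
  by apply/set0Pn; exists v.
by rewrite inner_setT cardsT; lia.
Qed.

(* Handshake lemma in the component of [c]. *)
Lemma odd_connect e c d : symmetric e -> irreflexive e -> odd (deg e c) ->
  (forall u, u != c -> u != d -> ~~ odd (deg e u)) -> connect e c d.
Proof.
move=> es ei oc ev; pose S := [set v | connect e c v].
have cS : c \in S by rewrite inE connect0.
have [//|] := boolP (d \in S); first by rewrite inE.
move=> dS; have := inner_even S es ei.
suff -> : inner e S = \sum_(u in S) deg e u.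
  rewrite (bigD1 c) //= oddD oc; suff -> : odd (\sum_(i in S | i != c) deg e i) = false by [].
  apply: (big_ind (fun n => odd n = false)) => // [a b|u /andP [uS uc]].
    by rewrite oddD => -> ->.
  by apply/negbTE/ev => //; apply: contraNneq dS => <-.
rewrite sum_deg_inner cut_sizeE big1 ?addn0 // => u _; rewrite big1 // => v _.
have [euv|//] := boolP (e u v); rewrite !inE.
by have [cu|] := boolP (connect e c u) => //=; rewrite (connect_trans cu) // connect1.
Qed.

(* In a cubic graph, two or more vertices bounded by at most three edges always contain a cycle,
   so for girth at least 5 this amounts to cyclic 4-edge-connectivity. *)
Definition three_edge_cut_trivial e :=
  forall S : {set V}, 2 <= #|S| -> 2 <= #|~: S| -> 4 <= cut_size e S.

(** In a cubic graph three times [#|T|] equals [inner] plus the cut size. With at least two vertices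
    and at most three cut edges, [inner] is at least twice [#|T|] minus 1, and [inner_cycle] yields
    a cycle on either side. *)
Lemma cyc4_trivial e : cubic e -> cyc4_edge_connected e -> three_edge_cut_trivial e.
Proof.
move=> [[es ei] e3] e4 S S2 SC2.
have H (T : {set V}) : 2 <= #|T| -> cut_size e T <= 3 -> has_cycle_in e T.
  move=> T2 cT; apply: inner_cycle => //; first by rewrite -card_gt0; lia.
  have := sum_deg_inner e T; rewrite (eq_bigr (fun=> 3)) => [|? _]; last exact: e3.
  by rewrite sum_nat_const; lia.
rewrite leqNgt; apply/negP => cS.
have := e4 S; rewrite leqNgt cS => /(_ _ _)/wrap [] //; apply: H => //.
by rewrite cut_sizeC.
Qed.

Lemma trivial_cyc4 e : three_edge_cut_trivial e -> cyc4_edge_connected e.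
Proof.
move=> H S; have C (T : {set V}) : has_cycle_in e T -> 2 <= #|T|.
  move=> [p [[up sp _] pT]]; apply: leq_trans (ltnW sp) _.
  by rewrite -(card_uniqP up); apply/subset_leq_card/subsetP.
by move=> /C S2 /C SC2; apply: H.
Qed.

Definition triangle_free e := forall u v w, e u v -> e v w -> e w u -> False.
(** Stated for closed walks, degenerate ones included, so that it can be used and proved by plain
    case analysis without distinctness conditions. *)
Definition square_free e := forall u v w z,
  e u v -> e v w -> e w z -> e z u -> u = w \/ v = z.

Lemma girth5_triangle_free e : irreflexive e -> girth_ge5 e -> triangle_free e.
Proof.
move=> ei g u v w uv vw wu; have := g [:: u; v; w] => /(_ _)/wrap [] //.
have ne x y : e x y -> x != y by move=> exy; apply: contraTneq exy => ->; rewrite ei.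
have nuw : u != w by rewrite eq_sym ne.
by split; rewrite //= ?uv ?vw ?wu // !inE !negb_or nuw !ne.
Qed.

Lemma girth5_square_free e : irreflexive e -> girth_ge5 e -> square_free e.
Proof.
move=> ei g u v w z uv vw wz zu.
have [->|nuw] := eqVneq u w; first by left.
have [->|nvz] := eqVneq v z; first by right.
have := g [:: u; v; w; z] => /(_ _)/wrap [] //.
split=> //=; rewrite ?uv ?vw ?wz ?zu // !inE /= andbT !negb_or nuw nvz.
have ne x y : e x y -> x != y by move=> exy; apply: contraTneq exy => ->; rewrite ei.
have nuz : u != z by rewrite eq_sym ne.
by rewrite nuz !ne.
Qed.

Lemma girth5 e : triangle_free e -> square_free e -> girth_ge5 e.
Proof.
move=> tf sf [|u [|v [|w [|z [|t p]]]]] [] //= up _.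
  by rewrite andbT => /and3P [uv vw wu]; case: (tf _ _ _ uv vw wu).
rewrite andbT => /and4P [uv vw wz zu].
move: up; rewrite !inE !negb_or.
by case: (sf _ _ _ _ uv vw wz zu) => ->; rewrite eqxx /= ?andbF.
Qed.

End Trees.

(** * Parity of 3-edge-colourings *)

Lemma I3_third (i j : 'I_3) : exists k, (k != i) && (k != j).
Proof.
apply/existsP; apply: contraT; rewrite negb_exists => /forallP H.
have : #|[set: 'I_3]| <= #|[set i; j]|.
  apply/subset_leq_card/subsetP => k _; have := H k.
  by rewrite !inE negb_and !negbK.
by rewrite cardsT card_ord cards2; case: (i != j).
Qed.

Lemma I3_eq (i j k l : 'I_3) :
  i != j -> k != i -> k != j -> l != i -> l != j -> k = l.
Proof.
move=> ij ki kj li lj; apply/eqP; apply: contraT => kl.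
have := max_card (mem [:: i; j; k; l]).
suff /card_uniqP -> : uniq [:: i; j; k; l] by rewrite card_ord.
by rewrite /= !inE !negb_or ij kl eq_sym ki eq_sym li [j == k]eq_sym kj [j == l]eq_sym lj.
Qed.

Section HalfEdges.
Variable V : finType.
Implicit Types (e : rel V) (p q u v : V) (h : V -> V -> 'I_3).

(* [h u v] colours the half of the edge uv at u; the two halves may get different colours. *)
Definition half_proper e h u :=
  forall v w, e u v -> e u w -> v != w -> h u v != h u w.

Definition nbrs3 e v p q r := uniq [:: p; q; r] /\ (forall z, e v z = (z \in [:: p; q; r])).

Lemma sum_pairs (L : seq (V * V)) (P F : rel V) : uniq L ->
  (forall u v, P u v = ((u, v) \in L)) ->
  \sum_u \sum_v ((P u v && F u v) : nat) = \sum_(z <- L) (F z.1 z.2 : nat).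
Proof.
move=> uL PL; rewrite pair_bigA [RHS]big_uniq //= [RHS]big_mkcond.
by apply: eq_bigr => -[u v] _ /=; rewrite PL; case: ifP.
Qed.

Lemma half_proper1 e h u i : deg e u = 3 -> half_proper e h u ->
  \sum_v ((e u v && (h u v == i)) : nat) = 1.
Proof.
move=> d3 hp; have inj : {in [set v | e u v] &, injective (h u)}.
  move=> v w; rewrite !inE => uv uw /eqP hvw.
  by apply/eqP; apply: contraT => /(hp _ _ uv uw); rewrite hvw.
have : i \in h u @: [set v | e u v].
  suff -> : h u @: [set v | e u v] = setT by rewrite inE.
  apply/eqP; rewrite eqEcard subsetT cardsT card_ord card_in_imset //=; by move: d3; rewrite /deg => ->.
case/imsetP => v; rewrite inE => euv ->.
rewrite (bigD1 v) //= euv eqxx big1 // => w nwv.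
by have [euw|//] := boolP (e u w); rewrite (negbTE (hp _ _ euw euv nwv)).
Qed.

(** Every vertex of [U] has exactly one half-edge of colour [i]. Those on edges of [r] pair up, as
    [r] is symmetric and [h] agrees on both halves, so the remaining ones have the parity of
    [#|U|]. *)
Lemma parity e h (U : {set V}) (r : rel V) i :
  (forall u, u \in U -> deg e u = 3) -> (forall u, u \in U -> half_proper e h u) ->
  symmetric r -> irreflexive r -> (forall u v, r u v -> e u v && (u \in U)) ->
  (forall u v, r u v -> h u v = h v u) ->
  odd (\sum_u \sum_v (([&& u \in U, e u v & ~~ r u v] && (h u v == i)) : nat)) = odd #|U|.
Proof.
move=> d3 hp rs ri rU rh; pose r' := [rel u v | r u v && (h u v == i)].
have ev : odd (inner r' setT) = false.
  apply: inner_even => u /=; last by rewrite ri.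
  by move=> v /=; rewrite rs; case E: (r v u) => //=; rewrite (rh _ _ E).
have -> : #|U| = inner r' setT +
    \sum_u \sum_v (([&& u \in U, e u v & ~~ r u v] && (h u v == i)) : nat).
  rewrite inner_setT -sum1_card big_mkcond -big_split /=.
  apply: eq_bigr => u _; rewrite degE -big_split /=.
  case: ifP => uU.
    apply: etrans (esym (half_proper1 i (d3 _ uU) (hp _ uU))) _; apply: eq_bigr => v _ /=.
    by have := rU u v; case: (r u v); case: (e u v); case: (_ == i) => // /(_ isT).
  rewrite big1 // => v _ /=; rewrite addn0.
  by have := rU u v; rewrite uU andbF; case: (r u v) => // /(_ isT).
by rewrite oddD ev.
Qed.

Lemma cubic_even e : cubic e -> odd #|V| = false.
Proof.
move=> [[es ei] e3]; have := inner_even setT es ei.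
rewrite inner_setT (eq_bigr (fun=> 3)) => [|u _]; last exact: e3.
by rewrite sum_nat_const oddM andbT.
Qed.

Lemma symmetric_colouring e h : symmetric e -> (forall u, half_proper e h u) ->
  (forall u v, e u v -> h u v = h v u) -> three_edge_colourable e.
Proof.
move=> es hp hs; exists (fun u v => if e u v then h u v else ord0); split=> [u v|u v w uv uw].
  by rewrite es; case: ifP => // vu; rewrite hs // es.
by rewrite uv uw; apply: hp.
Qed.

(** If the halves of [ab] agreed, they would contribute 0 or 2 to the number of halves of [ab] and
    [cd] with colour [h c d]. That number is even by [parity], so the halves of [cd] would agree too
    and [h] would be a colouring of [e]. *)
Lemma half_edges_neq e a b c d h : cubic e -> ~ three_edge_colourable e ->
  e a b -> e c d -> uniq [:: a; b; c; d] -> (forall u, half_proper e h u) ->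
  (forall u v, e u v -> ~~ is_edge a b u v -> ~~ is_edge c d u v -> h u v = h v u) ->
  h a b != h b a.
Proof.
move=> ce ncol eab ecd uq hp hs; apply/eqP => hab; apply: ncol.
have [[es ei] e3] := ce.
pose r := [rel u v | [&& e u v, ~~ is_edge a b u v & ~~ is_edge c d u v]].
have rs : symmetric r by move=> u v /=; rewrite es is_edgeC [is_edge c d u v]is_edgeC.
have ri : irreflexive r by move=> u /=; rewrite ei.
have rU u v : r u v -> e u v && (u \in setT) by rewrite in_setT andbT => /andP [].
have rh u v : r u v -> h u v = h v u by case/and3P; apply: hs.
have := @parity e h setT r (h c d) (fun u _ => e3 u) (fun u _ => hp u) rs ri rU rh.
rewrite (@sum_pairs [:: (a, b); (b, a); (c, d);
  (d, c)] (fun u v => [&& u \in setT, e u v & ~~ r u v]) (fun u v => h u v == h c d)) /=; first last.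
- move=> u v; rewrite !inE !xpair_eqE /is_edge /=.
  apply/idP/idP => [|/or4P [] /andP [/eqP -> /eqP ->]]; last 4 first.
  - by rewrite eab !eqxx.
  - by rewrite es eab !eqxx /= orbT.
  - by rewrite ecd !eqxx /= andbF.
  - by rewrite es ecd !eqxx /= orbT andbF.
  by case/andP => euv; rewrite euv /= -negb_or negbK -orbA.
- move: uq; rewrite /= !inE !xpair_eqE !negb_or => /and4P [/and3P [ab ac ad] /andP [bc bd] cd _].
  by rewrite (negbTE ab) (negbTE ac) (negbTE ad) (negbTE bc) (negbTE bd) (negbTE cd).
rewrite !big_cons big_nil /= eqxx hab cardsT (cubic_even ce) => par.
have hcd : h c d = h d c.
  apply/eqP; rewrite eq_sym; apply: contraT => ncd; move: par; rewrite (negbTE ncd).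
  by case: (h b a == h c d).
apply: (symmetric_colouring es hp) => u v euv.
have [|nab] := boolP (is_edge a b u v); first by case/orP => /andP [/eqP -> /eqP ->].
have [|ncd] := boolP (is_edge c d u v); first by case/orP => /andP [/eqP -> /eqP ->].
exact: hs.
Qed.

(** By [parity] on the graph without [x] and [y], each colour occurs an even number of times on the
    four half-edges at [x1], [x2], [y1], [y2]. If those at [x1] and [x2] differed, those at [y1] and
    [y2] would show the same two colours, and the third colour on [xy] would complete a
    colouring. *)
Lemma half_edges_eq e x y x1 x2 y1 y2 h : cubic e -> ~ three_edge_colourable e ->
  nbrs3 e x y x1 x2 -> nbrs3 e y x y1 y2 -> uniq [:: x; y; x1; x2; y1; y2] ->
  (forall u, u != x -> u != y -> half_proper e h u) ->
  (forall u v, e u v -> u != x -> u != y -> v != x -> v != y -> h u v = h v u) ->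
  h x1 x = h x2 x.
Proof.
move=> ce ncol [uNx Nx] [uNy Ny] uq hp hs; apply/eqP; apply: contraT => nx; exfalso; apply: ncol.
have [[es ei] e3] := ce.
move: uq; rewrite /= !inE !negb_or => /and5P [/and5P [xy xx1 xx2 xy1 xy2]
  /and4P [yx1 yx2 yy1 yy2] /and3P [x12 x1y1 x1y2] /andP [x2y1 x2y2] /andP [y12 _]].
pose U := ~: [set x; y].
have inU u : (u \in U) = (u != x) && (u != y) by rewrite !inE negb_or.
pose r := [rel u v | [&& e u v, u \in U & v \in U]].
have par i : odd ((h x1 x == i) + (h x2 x == i) + (h y1 y == i) + (h y2 y == i)) = false.
  have := @parity e h U r i.
  rewrite (@sum_pairs [:: (x1, x); (x2, x); (y1, y);
    (y2, y)] (fun u v => [&& u \in U, e u v & ~~ r u v]) (fun u v => h u v == i)) /=; first last.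
  - move=> u v; rewrite !inE !xpair_eqE /=.
    apply/idP/idP => [|/or4P [] /andP [/eqP -> /eqP ->]]; last 4 first.
    - by rewrite es Nx !inE !eqxx !negb_or eq_sym xx1 eq_sym yx1 /= ?orbT ?andbF.
    - by rewrite es Nx !inE !eqxx !negb_or eq_sym xx2 eq_sym yx2 /= ?orbT ?andbF.
    - by rewrite es Ny !inE !eqxx !negb_or eq_sym xy1 eq_sym yy1 /= ?orbT ?andbF.
    - by rewrite es Ny !inE !eqxx !negb_or eq_sym xy2 eq_sym yy2 /= ?orbT ?andbF.
    rewrite !negb_or => /and3P [/andP [ux uy] euv]; rewrite euv ux uy /= negb_and !negbK.
    case/orP => /eqP E; move: euv; rewrite E es ?Nx ?Ny !inE ?(negbTE ux) ?(negbTE uy) /=;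
      by case/orP => ->; rewrite !eqxx ?orbT.
  - rewrite /= !inE !xpair_eqE !negb_or (negbTE x12) (negbTE x1y1) (negbTE x1y2).
    by rewrite (negbTE x2y1) (negbTE x2y2) (negbTE y12).
  rewrite !big_cons big_nil /= addn0 !addnA => -> //.
  - have := cardsC [set x; y]; rewrite cards2 xy /= -/U => cU.
    by have := cubic_even ce; rewrite -cU oddD.
  - by move=> u; rewrite inU => /andP []; apply: hp.
  - by move=> u v /=; rewrite es; case: (e v u) => //=; rewrite andbC.
  - by move=> u /=; rewrite ei.
  - by move=> u v /and3P [-> ->].
  - by move=> u v /and3P [euv]; rewrite !inU => /andP [? ?] /andP [? ?]; apply: hs.
have [k /andP [k1 k2]] := I3_third (h x1 x) (h x2 x).
have hy : (h y1 y != h y2 y) && (h y1 y != k) && (h y2 y != k).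
  have := par (h x1 x); have := par (h x2 x).
  rewrite !eqxx [h x2 x == h x1 x]eq_sym (negbTE nx).
  have [E1|_] := eqVneq (h y1 y) (h x1 x).
    rewrite E1 (negbTE nx) => + _.
    have [-> _|] := eqVneq (h y2 y) (h x2 x); last by [].
    by rewrite nx eq_sym k1 eq_sym k2.
  have [E2|] := eqVneq (h y2 y) (h x1 x); last by case: (h y1 y == h x2 x).
  rewrite E2 (negbTE nx) => + _.
  have [-> _|] := eqVneq (h y1 y) (h x2 x); last by [].
  by rewrite eq_sym nx eq_sym k2 eq_sym k1.
case/andP: hy => /andP [hy12 hy1] hy2.
(* An edge takes the colour of a half outside [x] and [y]; only [xy] has no such half and gets
   [k]. *)
pose c u v := if u \in U then h u v else if v \in U then h v u else k.
have xU : (x \in U) = false by rewrite inU eqxx.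
have yU : (y \in U) = false by rewrite inU eqxx andbF.
have x1U : x1 \in U by rewrite inU eq_sym xx1 eq_sym yx1.
have x2U : x2 \in U by rewrite inU eq_sym xx2 eq_sym yx2.
have y1U : y1 \in U by rewrite inU eq_sym xy1 eq_sym yy1.
have y2U : y2 \in U by rewrite inU eq_sym xy2 eq_sym yy2.
apply: (@symmetric_colouring e c es) => [u v w|u v euv]; last first.
  rewrite /c; case uU: (u \in U); case vU: (v \in U) => //.
  by move: uU vU; rewrite !inU => /andP [? ?] /andP [? ?]; apply: hs.
rewrite /c; case uU: (u \in U).
  by move: uU; rewrite inU => /andP [? ?] uv uw vw; apply: hp.
move/negbT: uU; rewrite inU negb_and !negbK => /orP [] /eqP ->.
  rewrite !Nx !in_cons !orbF => /or3P [] /eqP -> /or3P [] /eqP ->; rewrite ?eqxx // => _;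
    by rewrite ?yU ?x1U ?x2U // eq_sym.
rewrite !Ny !in_cons !orbF => /or3P [] /eqP -> /or3P [] /eqP ->; rewrite ?eqxx // => _;
  by rewrite ?xU ?y1U ?y2U // eq_sym.
Qed.
End HalfEdges.

(** * The dot product *)

Lemma inl_eqE (A B : eqType) (u v : A) : (inl u == inl v :> A + B) = (u == v).
Proof. by []. Qed.
Lemma inr_eqE (A B : eqType) (u v : B) : (inr u == inr v :> A + B) = (u == v).
Proof. by []. Qed.
Lemma inlr_eqE (A B : eqType) (u : A) (v : B) : (inl u == inr v :> A + B) = false.
Proof. by []. Qed.
Lemma inrl_eqE (A B : eqType) (u : A) (v : B) : (inr v == inl u :> A + B) = false.
Proof. by []. Qed.
Definition sumE := (inl_eqE, inr_eqE, inlr_eqE, inrl_eqE).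

Section SumRel.
Variables VG VH : finType.
Implicit Types (eG : rel VG) (eH : rel VH).

Definition sumrel eG eH : rel (VG + VH) := fun u v =>
  match u, v with
  | inl u, inl v => eG u v
  | inr u, inr v => eH u v
  | _, _ => false
  end.

Lemma sumrel_sym eG eH : symmetric eG -> symmetric eH -> symmetric (sumrel eG eH).
Proof. by move=> sG sH [u|u] [v|v] /=. Qed.

Lemma sumrel_irr eG eH : irreflexive eG -> irreflexive eH -> irreflexive (sumrel eG eH).
Proof. by move=> iG iH [u|u] /=. Qed.

Lemma deg_suml eG eH u : deg (sumrel eG eH) (inl u) = deg eG u.
Proof. by rewrite !degE big_sumType /= [X in _ + X]big1 ?addn0. Qed.

Lemma deg_sumr eG eH v : deg (sumrel eG eH) (inr v) = deg eH v.
Proof. by rewrite !degE big_sumType /= [X in X + _]big1 ?add0n. Qed.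

Lemma cut_sum eG eH (S : {set VG + VH}) :
  cut_size (sumrel eG eH) S = cut_size eG (inl @^-1: S) + cut_size eH (inr @^-1: S).
Proof.
rewrite !cut_sizeE big_sumType /=; congr (_ + _); apply: eq_bigr => u _.
  rewrite big_sumType /= [X in _ + X]big1 ?addn0 //.
  by apply: eq_bigr => v _; rewrite !inE.
rewrite big_sumType /= [X in X + _]big1 ?add0n //.
by apply: eq_bigr => v _; rewrite !inE.
Qed.

Lemma card_sum_set (S : {set VG + VH}) : #|S| = #|inl @^-1: S| + #|inr @^-1: S|.
Proof.
rewrite -!sum1_card big_mkcond big_sumType /=; congr (_ + _); rewrite [RHS]big_mkcond /=;
  by apply: eq_bigr => u _; rewrite inE.
Qed.

End SumRel.

Ltac edge_simp := rewrite ?/add_edge ?/del_edge ?/is_edge ?sumE /=.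
Ltac solve_sym := repeat first
  [ assumption | done | apply: add_edge_sym | apply: del_edge_sym | apply: sumrel_sym ].

Ltac nat_lia := clear;
  repeat match goal with |- context [nat_of_bool ?b] =>
    let n := fresh in set n := (nat_of_bool b); clearbody n end;
  repeat match goal with |- context [cut_size ?e ?S] =>
    let n := fresh in set n := (cut_size e S); clearbody n end;
  repeat match goal with |- context [deg ?e ?v] =>
    let n := fresh in set n := (deg e v); clearbody n end; lia.

Section DotOps.
Variables VG VH : finType.
Variables (a b c d : VG) (x y x2 y1 y2 : VH).
Hypotheses (uG : uniq [:: a; b; c; d]) (uH : uniq [:: x; y; x2; y1; y2]).
Implicit Types (eG : rel VG) (eH : rel VH) (e : rel (VG + VH)).

(* [opA] and [opB] separate the edges affecting the tree in case (2) from the others. *)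
Definition opA eG eH : rel (VG + VH) :=
  add_edge (inr y) (inr x2) (add_edge (inl b) (inr y) (add_edge (inl a) (inr x)
  (del_edge (inr x) (inr x2) (del_edge (inl a) (inl b) (sumrel eG eH))))).

Definition opB e : rel (VG + VH) :=
  add_edge (inl d) (inr y2) (add_edge (inl c) (inr y1)
  (del_edge (inr y) (inr y2) (del_edge (inr y) (inr y1) (del_edge (inl c) (inl d) e)))).

Definition dotp eG eH := opB (opA eG eH).

Lemma opA_sym eG eH : symmetric eG -> symmetric eH -> symmetric (opA eG eH).
Proof. by move=> sG sH; solve_sym. Qed.

Lemma opB_sym e : symmetric e -> symmetric (opB e).
Proof. by move=> es; solve_sym. Qed.

Let neG := uniq4_neq uG.
Let neH := uniq5_neq uH.

Ltac dside := edge_simp; rewrite ?neG ?neH ?eqxx ?andbF ?orbF ?andbT /=; auto.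

(** [y] gains [b] and [x2], while [a], [b], [x] and [x2] each trade one neighbour for another. *)
Lemma deg_opA eG eH : symmetric eG -> symmetric eH -> eG a b -> eH x x2 -> ~~ eH y x2 ->
  (forall u, deg (opA eG eH) (inl u) = deg eG u) /\
  (forall v, deg (opA eG eH) (inr v) = deg eH v + (v == y).*2).
Proof.
move=> sG sH eab exx2 nyx2.
(* Deleted edges stand on the left and added ones on the right, so that no truncated subtraction
   occurs; the cut identities have the same form. *)
have dA z : deg (opA eG eH) z + (z == inl a) + (z == inl b) + (z == inr x) + (z == inr x2)
   = deg (sumrel eG eH) z + (z == inl a) + (z == inr x) + (z == inl b) + (z == inr y)
     + (z == inr y) + (z == inr x2).
  rewrite /opA !deg_add; try solve [solve_sym | dside].
  rewrite (@deg_del _ (inl a) (inl b) (sumrel eG eH)); try solve [solve_sym | dside].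
  rewrite (@deg_del _ (inr x) (inr x2) (del_edge (inl a) (inl b) _)); try solve [solve_sym | dside].
  by nat_lia.
split=> u; [have := dA (inl u); rewrite deg_suml | have := dA (inr u); rewrite deg_sumr];
  rewrite !sumE /=; nat_lia.
Qed.

Lemma deg_opB e : symmetric e -> e (inl c) (inl d) -> e (inr y) (inr y1) -> e (inr y) (inr y2) ->
  ~~ e (inl c) (inr y1) -> ~~ e (inl d) (inr y2) ->
  (forall u, deg (opB e) (inl u) = deg e (inl u)) /\
  (forall v, deg (opB e) (inr v) + (v == y).*2 = deg e (inr v)).
Proof.
move=> es ecd ey1 ey2 nc nd.
have dB z : deg (opB e) z + (z == inl c) + (z == inl d) + (z == inr y) + (z == inr y1)
     + (z == inr y) + (z == inr y2)
   = deg e z + (z == inl c) + (z == inr y1) + (z == inl d) + (z == inr y2).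
  rewrite /opB !deg_add; try solve [solve_sym | dside].
  rewrite (@deg_del _ (inl c) (inl d) e); try solve [solve_sym | dside].
  rewrite (@deg_del _ (inr y) (inr y1) (del_edge (inl c) (inl d) e)); try solve [solve_sym | dside].
  rewrite (@deg_del _ (inr y) (inr y2) (del_edge (inr y) (inr y1) (del_edge (inl c) (inl d) e)));
    try solve [solve_sym | dside].
  by nat_lia.
by split=> u; [have := dB (inl u) | have := dB (inr u)]; rewrite !sumE /=; nat_lia.
Qed.

Lemma deg_dotp eG eH : symmetric eG -> symmetric eH -> eG a b -> eG c d ->
  eH x x2 -> eH y y1 -> eH y y2 -> ~~ eH y x2 ->
  (forall u, deg (dotp eG eH) (inl u) = deg eG u) /\
  (forall v, deg (dotp eG eH) (inr v) = deg eH v).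
Proof.
move=> sG sH eab ecd exx2 ey1 ey2 nyx2.
have [dAl dAr] := deg_opA sG sH eab exx2 nyx2.
have [|||||| dBl dBr] := @deg_opB (opA eG eH); try solve [exact: opA_sym | rewrite /opA; dside].
by split=> u; [rewrite -dAl -dBl | have := dAr u; have := dBr u; rewrite /dotp; nat_lia].
Qed.

Lemma cut_opA eG eH S : symmetric eG -> symmetric eH -> eG a b -> eH x x2 -> ~~ eH y x2 ->
  cut_size (opA eG eH) S + ((inl a \in S) != (inl b \in S)) + ((inr x \in S) != (inr x2 \in S))
  = cut_size eG (inl @^-1: S) + cut_size eH (inr @^-1: S) + ((inl a \in S) != (inr x \in S)) +
    ((inl b \in S) != (inr y \in S)) + ((inr y \in S) != (inr x2 \in S)).
Proof.
move=> sG sH eab exx2 nyx2; rewrite -cut_sum.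
rewrite /opA !cut_add; try solve [solve_sym | dside].
rewrite (@cut_del _ (inl a) (inl b) (sumrel eG eH)); try solve [solve_sym | dside].
rewrite (@cut_del _ (inr x) (inr x2) (del_edge (inl a) (inl b) _)); try solve [solve_sym | dside].
by nat_lia.
Qed.

Lemma cut_opB e S : symmetric e -> e (inl c) (inl d) -> e (inr y) (inr y1) -> e (inr y) (inr y2) ->
  ~~ e (inl c) (inr y1) -> ~~ e (inl d) (inr y2) ->
  cut_size (opB e) S + ((inl c \in S) != (inl d \in S)) + ((inr y \in S) != (inr y1 \in S))
    + ((inr y \in S) != (inr y2 \in S))
  = cut_size e S + ((inl c \in S) != (inr y1 \in S)) + ((inl d \in S) != (inr y2 \in S)).
Proof.
move=> es ecd ey1 ey2 nc nd.
rewrite /opB !cut_add; try solve [solve_sym | dside].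
rewrite (@cut_del _ (inl c) (inl d) e); try solve [solve_sym | dside].
rewrite (@cut_del _ (inr y) (inr y1) (del_edge (inl c) (inl d) e)); try solve [solve_sym | dside].
rewrite (@cut_del _ (inr y) (inr y2) (del_edge (inr y) (inr y1) (del_edge (inl c) (inl d) e)));
  try solve [solve_sym | dside].
by nat_lia.
Qed.

Lemma cut_dotp eG eH S : symmetric eG -> symmetric eH -> eG a b -> eG c d ->
  eH x x2 -> eH y y1 -> eH y y2 -> ~~ eH y x2 ->
  cut_size (dotp eG eH) S + ((inl a \in S) != (inl b \in S)) + ((inr x \in S) != (inr x2 \in S))
    + ((inl c \in S) != (inl d \in S)) + ((inr y \in S) != (inr y1 \in S))
    + ((inr y \in S) != (inr y2 \in S))
  = cut_size eG (inl @^-1: S) + cut_size eH (inr @^-1: S) + ((inl a \in S) != (inr x \in S)) +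
    ((inl b \in S) != (inr y \in S)) + ((inr y \in S) != (inr x2 \in S))
    + ((inl c \in S) != (inr y1 \in S)) + ((inl d \in S) != (inr y2 \in S)).
Proof.
move=> sG sH eab ecd exx2 ey1 ey2 nyx2.
rewrite -(cut_opA S sG sH eab exx2 nyx2) -addnA addnAC -addnA.
have := @cut_opB (opA eG eH) S.
move=> /(_ _ _ _ _ _ _)/wrap [||||||H]; try solve [exact: opA_sym | rewrite /opA; dside].
by move: H; rewrite /dotp; nat_lia.
Qed.

End DotOps.

(** * Cuts of the dot product: reduction to a finite inequality *)

Section CutBounds.
Variable V : finType.
Implicit Types (e : rel V) (S : {set V}) (p q r s x y : V).

(* Lower bound for a cut with [n] and [m] vertices on its sides. *)
Definition cut_bound n m :=
  if (n == 0) || (m == 0) then 0 else if (n == 1) || (m == 1) then 3 else 4.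

Lemma cut_bound_min n m : cut_bound (minn n 2) (minn m 2) = cut_bound n m.
Proof. by case: n m => [|[|n]] [|[|m]]. Qed.

Lemma cut_size_ge e S : cubic e -> three_edge_cut_trivial e ->
  cut_bound #|S| #|~: S| <= cut_size e S.
Proof.
move=> [[es ei] e3] e4; have one (T : {set V}) : #|T| = 1 -> cut_size e T = 3.
  move/eqP/cards1P => [v ->]; rewrite -(e3 v).
  by have := sum_deg_inner e [set v]; rewrite /inner !big_set1 ei.
rewrite /cut_bound; case: ifP => // n0; case: ifP => [/orP [] /eqP c1|n1].
- by rewrite one.
- by rewrite -cut_sizeC // one.
by apply: e4; lia.
Qed.

Lemma card_ge4 S p q r s : uniq [:: p; q; r; s] ->
  (p \in S) + (q \in S) + (r \in S) + (s \in S) <= #|S|.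
Proof.
move=> uL; have -> : (p \in S) + (q \in S) + (r \in S) + (s \in S) =
    size (filter (mem S) [:: p; q; r; s]).
  by rewrite size_filter /= addn0 !addnA.
rewrite -(card_uniqP (filter_uniq _ uL)).
by apply/subset_leq_card/subsetP => v; rewrite mem_filter => /andP [].
Qed.

Definition set_mem2 x y S (bx by_ : bool) :=
  [set v | if v == x then bx else if v == y then by_ else v \in S].

Lemma card_set_mem2 x y S bx by_ : x != y ->
  #|set_mem2 x y S bx by_| = #|S :\ x :\ y| + bx + by_.
Proof.
move=> xy; rewrite (cardsD1 x) (cardsD1 y) !inE eqxx eq_sym (negbTE xy) eqxx /=.
have -> : set_mem2 x y S bx by_ :\ x :\ y = S :\ x :\ y.
  by apply/setP => v; rewrite !inE; case: (v == x); case: (v == y).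
by lia.
Qed.

Lemma set_mem2C x y S bx by_ :
  ~: set_mem2 x y S bx by_ = set_mem2 x y (~: S) (~~ bx) (~~ by_).
Proof. by apply/setP => v; rewrite !inE; case: (v == x) => //; case: (v == y). Qed.

End CutBounds.

(** Boolean quantifiers turn the inequality into one closed boolean that [vm_compute] evaluates. *)
Definition all_bool (f : bool -> bool) := f true && f false.
Definition all_lt3 (f : nat -> bool) := [&& f 0, f 1 & f 2].

Lemma all_boolP f : all_bool f -> forall b, f b.
Proof. by case/andP => ? ? []. Qed.

Lemma all_lt3P f : all_lt3 f -> forall n, f (minn n 2).
Proof. by case/and3P => ? ? ? [|[|n]]. Qed.

(* Lower bound for the edges of [H - x - y] cut by [B], obtained by moving [x] and [y] freely. *)
Definition free_bound nB mB (x1 x2 y1 y2 u v : bool) :=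
  cut_bound (nB + u + v) (mB + ~~ u + ~~ v)
  - ((u != x1) + (u != x2) + (u != v) + (v != y1) + (v != y2)).

(** Truncation at 2 loses nothing here: below 2 it is exact, and from 2 on the first disjunct
    holds. *)
Lemma leq_minn2 n k : k <= n -> (1 < minn n 2) || (k <= minn n 2).
Proof. by lia. Qed.

Lemma ltn_minn2_add n m i j : 1 < n + m + i + j -> 1 < minn n 2 + minn m 2 + i + j.
Proof. by lia. Qed.

Lemma free_bound_min nB mB x1 x2 y1 y2 u v :
  free_bound (minn nB 2) (minn mB 2) x1 x2 y1 y2 u v = free_bound nB mB x1 x2 y1 y2 u v.
Proof. by rewrite /free_bound; congr (_ - _); case: nB mB u v => [|[|n]] [|[|m]] [] []. Qed.

(* All bounds depend on the numbers of vertices only up to 2, so the inequality is a finite check. *)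
Definition dot_ineq nA mA nB mB (a b c d x y x1 x2 y1 y2 : bool) :=
  [&& (1 < nA) || (a + b + c + d <= nA), (1 < mA) || (~~ a + ~~ b + ~~ c + ~~ d <= mA),
      (1 < nB) || (x1 + x2 + y1 + y2 <= nB), (1 < mB) || (~~ x1 + ~~ x2 + ~~ y1 + ~~ y2 <= mB),
      1 < nA + nB + x + y & 1 < mA + mB + ~~ x + ~~ y] ==>
  (4 + (a != b) + (c != d) <= cut_bound nA mA
    + maxn (maxn (free_bound nB mB x1 x2 y1 y2 true true) (free_bound nB mB x1 x2 y1 y2 true false))
           (maxn (free_bound nB mB x1 x2 y1 y2 false true) (free_bound nB mB x1 x2 y1 y2 false false))
    + (x != x1) + (x != y) + (a != x) + (b != y) + (y != x2) + (c != y1) + (d != y2)).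

(** 81 times 1024 cases. The premises of [dot_ineq] say that each side has at least the named
    vertices found on it, and at least two vertices in all. In its conclusion the deleted edges [ab]
    and [cd] stand on the left; on the right, the bounds for [G] and for [H - x - y] are followed by
    the remaining edges of the product. *)
Lemma dot_ineq_check : all_lt3 (fun nA => all_lt3 (fun mA => all_lt3 (fun nB => all_lt3 (fun mB =>
  all_bool (fun a => all_bool (fun b => all_bool (fun c => all_bool (fun d => all_bool (fun x =>
  all_bool (fun y => all_bool (fun x1 => all_bool (fun x2 => all_bool (fun y1 =>
  all_bool (fun y2 => dot_ineq nA mA nB mB a b c d x y x1 x2 y1 y2)))))))))))))).
Proof. by vm_compute. Qed.

(** * Degrees, cuts and girth of the dot product *)

Section DotSnark.
Variables (VG VH : finType) (adjG : rel VG) (adjH : rel VH).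
Variables (a b c d : VG) (x y x1 x2 y1 y2 : VH).
Hypotheses (cG : cubic adjG) (cH : cubic adjH).
Hypotheses (eab : adjG a b) (ecd : adjG c d) (uG : uniq [:: a; b; c; d]).
Hypotheses (Nx : nbrs3 adjH x y x1 x2) (Ny : nbrs3 adjH y x y1 y2).
Hypotheses (tG : triangle_free adjG) (tH : triangle_free adjH).

Let sG : symmetric adjG. Proof. by case: cG => [[]]. Qed.
Let sH : symmetric adjH. Proof. by case: cH => [[]]. Qed.
Let iG : irreflexive adjG. Proof. by case: cG => [[]]. Qed.
Let iH : irreflexive adjH. Proof. by case: cH => [[]]. Qed.

Let exy : adjH x y. Proof. by case: Nx => _ ->; rewrite !inE eqxx. Qed.
Let exx1 : adjH x x1. Proof. by case: Nx => _ ->; rewrite !inE eqxx orbT. Qed.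
Let exx2 : adjH x x2. Proof. by case: Nx => _ ->; rewrite !inE eqxx !orbT. Qed.
Let eyy1 : adjH y y1. Proof. by case: Ny => _ ->; rewrite !inE eqxx orbT. Qed.
Let eyy2 : adjH y y2. Proof. by case: Ny => _ ->; rewrite !inE eqxx !orbT. Qed.

(** A coincidence between a neighbour of [x] and a neighbour of [y] would be a triangle on the edge
    [xy]. *)
Lemma dot_uniq : uniq [:: x; y; x1; x2; y1; y2].
Proof.
have ne u v : adjH u v -> u == v = false by move=> e; apply: contraTF e => /eqP ->; rewrite iH.
have nt u v : adjH x u -> adjH y v -> u == v = false.
  by move=> xu yv; apply/eqP => E; apply: (@tH x u y); rewrite // 1?sH // E.
case: Nx => ux _; case: Ny => uy _; move: ux uy; rewrite /= !inE !negb_or !andbT.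
move=> /andP [/andP [yx1 yx2] x12] /andP [/andP [xy1 xy2] y12].
rewrite yx1 yx2 x12 xy1 xy2 y12 (ne _ _ exy) (ne _ _ exx1) (ne _ _ exx2) (ne _ _ eyy1) (ne _ _ eyy2).
by rewrite (nt _ _ exx1 eyy1) (nt _ _ exx1 eyy2) (nt _ _ exx2 eyy1) (nt _ _ exx2 eyy2).
Qed.

Let uH5 : uniq [:: x; y; x2; y1; y2].
Proof. exact: (mask_uniq dot_uniq [:: true; true; false; true; true; true]). Qed.

Let neH := uniq6_neq dot_uniq.

Let neG := uniq4_neq uG.

Lemma dot_nyx2 : ~~ adjH y x2.
Proof. by case: Ny => _ ->; rewrite !inE ?neH. Qed.

Local Notation D := (dotp a b c d x y x2 y1 y2 adjG adjH).

Lemma dot_sym : symmetric D.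
Proof. by apply/opB_sym/opA_sym. Qed.

Lemma dot_irr : irreflexive D.
Proof.
by repeat first [apply: add_edge_irr; first by rewrite ?sumE ?neH
  | apply: del_edge_irr | apply: sumrel_irr].
Qed.

Lemma dot_cubic : cubic D.
Proof.
split; first by split; [exact: dot_sym | exact: dot_irr].
have [dl dr] := deg_dotp uG uH5 sG sH eab ecd exx2 eyy1 eyy2 dot_nyx2.
by case=> v; rewrite ?dl ?dr; [case: cG | case: cH].
Qed.

Lemma dot_ll u v : D (inl u) (inl v) = [&& adjG u v, ~~ is_edge a b u v & ~~ is_edge c d u v].
Proof. by rewrite /dotp /opB /opA /add_edge /del_edge /is_edge !sumE /= ?andbF ?orbF ?andbT -?andbA. Qed.

Lemma dot_lr u v : D (inl u) (inr v) =
  [|| (u == a) && (v == x), (u == b) && (v == y), (u == c) && (v == y1) | (u == d) && (v == y2)].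
Proof.
rewrite /dotp /opB /opA /add_edge /del_edge /is_edge !sumE /= ?andbF ?orbF ?andbT.
by rewrite -!orbA.
Qed.

Lemma dot_rr u v : D (inr u) (inr v) =
  adjH u v && ~~ is_edge x x2 u v && ~~ is_edge y y1 u v && ~~ is_edge y y2 u v || is_edge y x2 u v.
Proof.
rewrite /dotp /opB /opA /add_edge /del_edge; have [|nE] := boolP (is_edge y x2 u v).
  by case/orP => /andP [/eqP -> /eqP ->]; rewrite /is_edge !sumE /= ?eqxx ?neH /= ?orbT.
move/negbTE: nE; rewrite /is_edge !sumE /= ?andbF ?orbF ?andbT => ->.
by rewrite !orbF.
Qed.

Ltac hside := solve_sym; rewrite /del_edge /is_edge ?neH ?eqxx ?andbF ?andbT /=; auto.

(** [S] splits into [A] in [G] and [B] in [H]. The cut of [A] is bounded in [G]. For [B], each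
    placement [u], [v] of [x] and [y] gives a set whose cut is bounded in [H]; subtracting its edges
    at [x] and [y] leaves a bound for the same edges of [H - x - y]. *)
Lemma dot_three_edge_cut :
  three_edge_cut_trivial adjG -> three_edge_cut_trivial adjH -> three_edge_cut_trivial D.
Proof.
move=> pG pH S S2 SC2.
have := cut_dotp uG uH5 S sG sH eab ecd exx2 eyy1 eyy2 dot_nyx2.
set A := inl @^-1: S; set B := inr @^-1: S.
have mA u : (inl u \in S) = (u \in A) by rewrite inE.
have mB u : (inr u \in S) = (u \in B) by rewrite inE.
rewrite !mA !mB => cutD.
move: S2 SC2; rewrite !card_sum_set -/A -/B !preimsetC -/A -/B => S2 SC2.
(* The edges of [H - x - y]: the five edges of [adjH] at [x] or [y] are removed. *)
pose H0 := del_edge y y2 (del_edge y y1 (del_edge x x2 (del_edge x y (del_edge x x1 adjH)))).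
have cutH (T : {set VH}) : cut_size adjH T = cut_size H0 T + ((x \in T) != (x1 \in T))
   + ((x \in T) != (x2 \in T)) + ((x \in T) != (y \in T)) + ((y \in T) != (y1 \in T)) + ((y \in T) !=
     (y2 \in T)).
  rewrite (@cut_del _ x x1 adjH); try solve [hside].
  rewrite (@cut_del _ x y (del_edge x x1 _)); try solve [hside].
  rewrite (@cut_del _ x x2 (del_edge x y _)); try solve [hside].
  rewrite (@cut_del _ y y1 (del_edge x x2 _)); try solve [hside].
  rewrite (@cut_del _ y y2 (del_edge y y1 _)); try solve [hside].
  by rewrite -/H0; nat_lia.
have H0xy u v : H0 u v -> [/\ u != x, u != y, v != x & v != y].
  have H0s : symmetric H0 by rewrite /H0; solve_sym.
  suff H p q : H0 p q -> p != x /\ p != y.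
    by move=> uv; have [? ?] := H _ _ uv; move: uv; rewrite H0s => /H [? ?].
  move=> pq; split; apply: contraTneq pq => ->.
    rewrite /H0 /del_edge /is_edge (proj2 Nx) !inE !eqxx ?neH /=.
    by case: (q == y); case: (q == x1); case: (q == x2); rewrite ?andbF.
  rewrite /H0 /del_edge /is_edge (proj2 Ny) !inE !eqxx ?neH /=.
  by case: (q == x); case: (q == y1); case: (q == y2); rewrite ?andbF.
have cutH0 (u v : bool) : cut_size H0 (set_mem2 x y B u v) = cut_size H0 B.
  congr #|pred_of_set _|; apply/setP => -[p q]; rewrite !inE /=.
  have [pq|//] := boolP (H0 p q); have [/negbTE -> /negbTE -> /negbTE -> /negbTE ->] := H0xy _ _ pq.
  by [].
pose B0 := B :\ x :\ y; pose B1 := ~: B :\ x :\ y.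
have low (u v : bool) : free_bound #|B0| #|B1| (x1 \in B) (x2 \in B) (y1 \in B) (y2 \in B) u v
   <= cut_size H0 B.
  have := cut_size_ge (set_mem2 x y B u v) cH pH.
  rewrite set_mem2C !card_set_mem2 ?neH // cutH cutH0 /free_bound -/B0 -/B1.
  rewrite !inE ?eqxx ?neH leq_subLR => /leq_trans; apply.
  by nat_lia.
have cA := card_ge4 A uG; have := card_ge4 (~: A) uG; rewrite !in_setC => cA'.
have uH4 : uniq [:: x1; x2; y1; y2] := mask_uniq dot_uniq [:: false; false; true; true; true; true].
have cB : (x1 \in B) + (x2 \in B) + (y1 \in B) + (y2 \in B) <= #|B0|.
  by have := card_ge4 B0 uH4; rewrite !in_setD1 ?neH.
have cB' : ~~ (x1 \in B) + ~~ (x2 \in B) + ~~ (y1 \in B) + ~~ (y2 \in B) <= #|B1|.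
  by have := card_ge4 B1 uH4; rewrite !in_setD1 !in_setC ?neH.
have cBE : #|B| = #|B0| + (x \in B) + (y \in B).
  by rewrite (cardsD1 x) (cardsD1 y) !in_setD1 neH /= -/B0; nat_lia.
have cBE' : #|~: B| = #|B1| + ~~ (x \in B) + ~~ (y \in B).
  by rewrite (cardsD1 x) (cardsD1 y) !in_setD1 !in_setC neH /= -/B1; nat_lia.
have lA := cut_size_ge A cG pG.
move: (all_lt3P dot_ineq_check #|A|) => /all_lt3P /(_ #|~: A|) /all_lt3P /(_ #|B0|).
move=> /all_lt3P /(_ #|B1|) /all_boolP /(_ (a \in A)) /all_boolP /(_ (b \in A)).
move=> /all_boolP /(_ (c \in A)) /all_boolP /(_ (d \in A)) /all_boolP /(_ (x \in B)).
move=> /all_boolP /(_ (y \in B)) /all_boolP /(_ (x1 \in B)) /all_boolP /(_ (x2 \in B)).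
move=> /all_boolP /(_ (y1 \in B)) /all_boolP /(_ (y2 \in B)) /implyP.
rewrite !cut_bound_min !free_bound_min => /(_ _)/wrap [|].
  rewrite !leq_minn2 //=; apply/andP; split; apply: ltn_minn2_add; first by move: S2; rewrite cBE !addnA.
  by move: SC2; rewrite cBE' !addnA.
set L := maxn (maxn _ _) _.
have lowL : L <= cut_size H0 B by rewrite !geq_max !low.
move: lowL lA cutD; rewrite (cutH B); move: L (cut_bound _ _).
by move: (cut_size D S) (cut_size adjG A) (cut_size H0 B); nat_lia.
Qed.


Lemma dot_rl u v : D (inr v) (inl u) = D (inl u) (inr v).
Proof. exact: dot_sym. Qed.

(** The four edges [ax], [by], [c y1], [d y2] between the two sides form a matching, which rules out
    most short cycles that meet both sides. *)
Lemma dot_cross_fun u v w : D (inl u) (inr v) -> D (inl u) (inr w) -> v = w.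
Proof.
rewrite !dot_lr => /or4P [] /andP [/eqP -> /eqP ->] /or4P [] /andP [];
  by rewrite ?neG // => _ /eqP.
Qed.

Lemma dot_cross_inj u v w : D (inl u) (inr w) -> D (inl v) (inr w) -> u = v.
Proof.
rewrite !dot_lr => /or4P [] /andP [/eqP -> /eqP ->] /or4P [] /andP [];
  by rewrite ?neH // => /eqP ->.
Qed.

(** Of the pairs of ends in [G], neither [ab] nor [cd] is still an edge. For the other pairs, the
    ends in [H] are one of [x], [y] and one of [y1], [y2]: [x] is adjacent to neither of the latter,
    and [y] no longer is. *)
Lemma dot_cross_square u v u' v' : D (inl u) (inr v) -> D (inl u') (inr v') ->
  D (inl u) (inl u') -> D (inr v) (inr v') -> False.
Proof.
rewrite !dot_lr dot_ll dot_rr /is_edge.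
move=> /or4P [] /andP [/eqP -> /eqP ->] /or4P [] /andP [/eqP -> /eqP ->];
  rewrite ?eqxx ?neG ?neH ?iG ?iH ?andbF ?orbF //=;
  rewrite ?(proj2 Nx) ?(proj2 Ny) -?(sH x) -?(sH y) ?(proj2 Nx) ?(proj2 Ny) !inE ?eqxx ?neH /= ?andbF //.
Qed.

Lemma dot_r_nbr v : D (inr y) (inr v) -> v = x \/ v = x2.
Proof.
rewrite dot_rr /is_edge (proj2 Ny) !inE !eqxx ?neH /= ?orbF.
have [->|_] := eqVneq v x; first by left.
have [->|_] := eqVneq v x2; first by right.
by case: (v == y1); case: (v == y2).
Qed.

Lemma dot_r_nxx2 : ~~ D (inr x) (inr x2).
Proof. by rewrite dot_rr /is_edge !eqxx ?neH /= ?andbF. Qed.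

Lemma dot_r_adj u v : u != y -> v != y -> D (inr u) (inr v) -> adjH u v.
Proof.
move=> /negbTE uy /negbTE vy; rewrite dot_rr [is_edge y x2 u v]/is_edge uy vy /= andbF orbF.
by case/andP => /andP [/andP []].
Qed.

(** The only edge on the right side that [H] lacks is [y x2]. A triangle there that avoids [y] lies
    in [H]; through [y] it would need the deleted edge [x x2]. The matching excludes triangles that
    meet both sides. *)
Lemma dot_triangle_free : triangle_free D.
Proof.
have r3 u v w : D (inr u) (inr v) -> D (inr v) (inr w) -> D (inr w) (inr u) -> False.
  have Hy p q : D (inr y) (inr p) -> D (inr p) (inr q) -> D (inr q) (inr y) -> False.
    rewrite [D (inr q) _]dot_sym => /dot_r_nbr [] -> pq /dot_r_nbr [] E; move: pq;
      by rewrite E ?dot_irr ?(negbTE dot_r_nxx2) 1?dot_sym ?(negbTE dot_r_nxx2).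
  move=> uv vw wu.
  have [E|uy] := eqVneq u y; first by subst u; exact: Hy uv vw wu.
  have [E|vy] := eqVneq v y; first by subst v; exact: Hy vw wu uv.
  have [E|wy] := eqVneq w y; first by subst w; exact: Hy wu uv vw.
  by apply: (@tH u v w); apply: dot_r_adj.
have llr u v w : D (inl u) (inl v) -> D (inl u) (inr w) -> D (inl v) (inr w) -> False.
  by move=> uv uw vw; move: uv; rewrite (dot_cross_inj uw vw) dot_irr.
have lrr u v w : D (inl u) (inr v) -> D (inl u) (inr w) -> D (inr v) (inr w) -> False.
  by move=> uv uw; rewrite (dot_cross_fun uv uw) dot_irr.
case=> [u|u] [v|v] [w|w] uv vw wu; rewrite ?dot_rl in uv vw wu.
- by move: uv vw wu; rewrite !dot_ll => /and3P [? _ _] /and3P [? _ _] /and3P [? _ _]; apply: (@tG u v w).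
- exact: llr uv wu vw.
- exact: llr wu vw uv.
- exact: lrr uv wu vw.
- exact: llr vw uv wu.
- exact: lrr vw uv wu.
- exact: lrr wu vw uv.
- exact: r3 uv vw wu.
Qed.

Hypotheses (qG : square_free adjG) (qH : square_free adjH).

(** In a square on the right side the neighbours of [y] are [x] and [x2]; another common neighbour
    [q] of these would form a triangle of [H] with the edge [x x2]. A square with two adjacent
    vertices on each side falls to [dot_cross_square], every other one that meets both sides to the
    matching. *)
Lemma dot_square_free : square_free D.
Proof.
have r4 u v w z : D (inr u) (inr v) -> D (inr v) (inr w) -> D (inr w) (inr z) ->
    D (inr z) (inr u) -> u = w \/ v = z.
  have Hxx2 q : D (inr x) (inr q) -> D (inr q) (inr x2) -> q = y.
    move=> xq qx2; apply/eqP; apply: contraT => qy; exfalso.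
    apply: (@tH x q x2); [apply: dot_r_adj xq|apply: dot_r_adj qx2|]; rewrite ?neH // sH //.
  have Hy p q r : D (inr y) (inr p) -> D (inr p) (inr q) -> D (inr q) (inr r) ->
      D (inr r) (inr y) -> y = q \/ p = r.
    rewrite [D (inr r) _]dot_sym => /dot_r_nbr pE pq qr /dot_r_nbr rE.
    case: pE pq => ->; case: rE qr => -> qr pq; try by right.
      by left; rewrite (Hxx2 q).
    by left; rewrite (Hxx2 q) // dot_sym.
  move=> uv vw wz zu.
  have [E|uy] := eqVneq u y; first by subst u; exact: Hy uv vw wz zu.
  have [E|vy] := eqVneq v y; first by subst v; case: (Hy _ _ _ vw wz zu uv) => ->; [right|left].
  have [E|wy] := eqVneq w y; first by subst w; case: (Hy _ _ _ wz zu uv vw) => ->; [left|right].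
  have [E|zy] := eqVneq z y; first by subst z; case: (Hy _ _ _ zu uv vw wz) => ->; [right|left].
  by apply: qH; apply: dot_r_adj.
have llrr u v w z : D (inl u) (inl v) -> D (inl v) (inr w) -> D (inr w) (inr z) ->
    D (inl u) (inr z) -> False.
  move=> uv vw wz uz; apply: dot_cross_square vw uz _ wz; by rewrite dot_sym.
case=> [u|u] [v|v] [w|w] [z|z] uv vw wz zu; rewrite ?dot_rl in uv vw wz zu.
- move: uv vw wz zu; rewrite !dot_ll => /and3P [uv _ _] /and3P [vw _ _] /and3P [wz _ _] /and3P [zu _ _].
  by case: (qG uv vw wz zu) => ->; [left|right].
- by left; rewrite (dot_cross_inj zu wz).
- by right; rewrite (dot_cross_inj vw wz).
- by case: (llrr _ _ _ _ uv vw wz zu).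
- by left; rewrite (dot_cross_inj uv vw).
- by left; rewrite (dot_cross_inj uv vw).
- by case: (llrr _ _ _ _ zu uv vw wz).
- by right; rewrite (dot_cross_fun uv zu).
- by right; rewrite (dot_cross_inj uv zu).
- by case: (llrr _ _ _ _ vw wz zu uv).
- by right; rewrite (dot_cross_inj uv zu).
- by left; rewrite (dot_cross_fun uv vw).
- by case: (llrr _ _ _ _ wz zu uv vw).
- by right; rewrite (dot_cross_fun vw wz).
- by left; rewrite (dot_cross_fun zu wz).
- by case: (r4 _ _ _ _ uv vw wz zu) => ->; [left|right].
Qed.

End DotSnark.

(** * Uncolourability of the dot product *)

Section DotColour.
Variables (VG VH : finType) (adjG : rel VG) (adjH : rel VH).
Variables (a b c d : VG) (x y x1 x2 y1 y2 : VH).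
Hypotheses (cG : cubic adjG) (cH : cubic adjH).
Hypotheses (eab : adjG a b) (ecd : adjG c d) (uG : uniq [:: a; b; c; d]).
Hypotheses (Nx : nbrs3 adjH x y x1 x2) (Ny : nbrs3 adjH y x y1 y2).
Hypotheses (tH : triangle_free adjH).

Let sH : symmetric adjH. Proof. by case: cH => [[]]. Qed.

Let neH := uniq6_neq (dot_uniq cH Nx Ny tH).
Let neG := uniq4_neq uG.

Local Notation D := (dotp a b c d x y x2 y1 y2 adjG adjH).

(** The other end of the product edge that replaces [uv] at [u]. Giving the half of [uv] at [u] the
    colour of that edge turns a colouring of the product into one of the half-edges of [G], with
    mismatches on [ab] and [cd] only. *)
Let nbrG u v : VG + VH :=
  if (u == a) && (v == b) then inr x else if (u == b) && (v == a) then inr y else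
  if (u == c) && (v == d) then inr y1 else if (u == d) && (v == c) then inr y2 else inl v.

(** The same for [H] away from [x] and [y]. The edge from [x1] to [x] survives in the product and
    needs no case. *)
Let nbrH u v : VG + VH :=
  if (u == x2) && (v == x) then inr y else if (u == y1) && (v == y) then inl c else
  if (u == y2) && (v == y) then inl d else inr v.

Let nbrG_adj u v : adjG u v -> D (inl u) (nbrG u v).
Proof.
rewrite /nbrG => uv; case: ifP => [/andP [/eqP -> _]|n1]; first by rewrite dot_lr !eqxx.
case: ifP => [/andP [/eqP -> _]|n2]; first by rewrite dot_lr !eqxx orbT.
case: ifP => [/andP [/eqP -> _]|n3]; first by rewrite dot_lr !eqxx !orbT.
case: ifP => [/andP [/eqP -> _]|n4]; first by rewrite dot_lr !eqxx !orbT.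
by rewrite dot_ll uv /is_edge n1 n2 n3 n4.
Qed.

Let nbrG_inj u v w : nbrG u v = nbrG u w -> v = w.
Proof.
rewrite /nbrG; have [->|] := eqVneq u a; rewrite ?neG /=.
  by do 2!case: eqP => [->|_] //; case.
have [->|] := eqVneq u b; rewrite ?neG /=.
  by move=> _; do 2!case: eqP => [->|_] //; case.
have [->|] := eqVneq u c; rewrite ?neG /=.
  by move=> _ _; do 2!case: eqP => [->|_] //; case.
have [->|] := eqVneq u d; rewrite ?neG /=.
  by move=> _ _ _; do 2!case: eqP => [->|_] //; case.
by move=> _ _ _ _ [].
Qed.

Let nbrH_adj u v : u != x -> u != y -> adjH u v -> D (inr u) (nbrH u v).
Proof.
rewrite /nbrH => /negbTE ux /negbTE uy uv.
case: ifP => [/andP [/eqP -> _]|n1]; first by rewrite (dot_rr adjG a b c d cH Nx Ny tH) /is_edge !eqxx !orbT.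
case: ifP => [/andP [/eqP -> _]|n2]; first by rewrite dot_rl // dot_lr !eqxx !orbT.
case: ifP => [/andP [/eqP -> _]|n3]; first by rewrite dot_rl // dot_lr !eqxx !orbT.
by rewrite (dot_rr adjG a b c d cH Nx Ny tH) uv /is_edge ux uy n1 n2 n3.
Qed.

Let nbrH_inj u v w : adjH u v -> adjH u w -> nbrH u v = nbrH u w -> v = w.
Proof.
rewrite /nbrH; have [->|] := eqVneq u x2; rewrite ?neH /=.
  (* [nbrH x2] sends [x] to [y]; this causes no clash, because [y] itself is not adjacent to [x2] in
     [H]. *)
  have ny z : adjH x2 z -> z != y.
    by apply: contraTneq => ->; rewrite sH (proj2 Ny) !inE ?neH.
  by move=> /ny vy /ny wy; do 2!case: eqP => [->|_] //; case => // E; [move: wy;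
    rewrite -E eqxx | move: vy; rewrite E eqxx].
have [->|] := eqVneq u y1; rewrite ?neH /=.
  by move=> _ _ _; do 2!case: eqP => [->|_] //; case.
have [->|] := eqVneq u y2; rewrite ?neH /=.
  by move=> _ _ _ _; do 2!case: eqP => [->|_] //; case.
by move=> _ _ _ _ _ [].
Qed.

Lemma dot_half_edges (h : VG + VH -> VG + VH -> 'I_3) :
  ~ three_edge_colourable adjG -> ~ three_edge_colourable adjH ->
  (forall u, half_proper D h u) ->
  (forall u v, D u v -> ~~ is_edge (inl c) (inr y1) u v -> ~~ is_edge (inl d) (inr y2) u v ->
     h u v = h v u) -> False.
Proof.
move=> nG nH hp hs.
have hG : h (inl a) (inr x) != h (inl b) (inr y).
  have /= := @half_edges_neq _ adjG a b c d (fun u v => h (inl u) (nbrG u v)) cG nG eab ecd uG.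
  rewrite /nbrG !eqxx ?neG /=; apply => [u v w uv uw nvw|u v uv].
    apply: hp; try exact: nbrG_adj.
    by apply: contraNneq nvw => /nbrG_inj ->.
  rewrite /is_edge !negb_or => /andP [/negbTE n1 /negbTE n2] /andP [/negbTE n3 /negbTE n4].
  have m1 : (v == a) && (u == b) = false by rewrite andbC.
  have m2 : (v == b) && (u == a) = false by rewrite andbC.
  have m3 : (v == c) && (u == d) = false by rewrite andbC.
  have m4 : (v == d) && (u == c) = false by rewrite andbC.
  rewrite n1 n2 n3 n4 m1 m2 m3 m4; apply: hs; rewrite ?/is_edge ?sumE ?andbF //.
  by rewrite dot_ll uv /is_edge n1 n2 n3 n4.
have hH : h (inr x1) (inr x) = h (inr x2) (inr y).
  have /= := @half_edges_eq _ adjH x y x1 x2 y1 y2 (fun u v => h (inr u) (nbrH u v)) cH nH Nx Ny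
    (dot_uniq cH Nx Ny tH).
  rewrite /nbrH !eqxx ?neH /= => H; apply: H => [u ux uy|u v uv].
    move=> v w uv uw nvw; apply: hp; try exact: nbrH_adj.
    by apply: contraNneq nvw => /nbrH_inj ->.
  move=> /negbTE ux /negbTE uy /negbTE vx /negbTE vy; rewrite ux uy vx vy !andbF.
  apply: hs; rewrite ?/is_edge ?sumE ?andbF //.
  by rewrite (dot_rr adjG a b c d cH Nx Ny tH) uv /is_edge ux uy vx vy !andbF.
have xa : D (inr x) (inl a) by rewrite dot_rl // dot_lr !eqxx.
have yb : D (inr y) (inl b) by rewrite dot_rl // dot_lr !eqxx orbT.
have xx1 : D (inr x) (inr x1).
  by rewrite (dot_rr adjG a b c d cH Nx Ny tH) (proj2 Nx) /is_edge !inE !eqxx ?neH /= ?andbF ?orbT.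
have xy : D (inr x) (inr y).
  by rewrite (dot_rr adjG a b c d cH Nx Ny tH) (proj2 Nx) /is_edge !inE !eqxx ?neH /= ?andbF ?orbT.
have yx : D (inr y) (inr x) by rewrite dot_sym.
have yx2 : D (inr y) (inr x2) by rewrite (dot_rr adjG a b c d cH Nx Ny tH) /is_edge !eqxx orbT.
case/eqP: hG.
have s u v : D u v -> ~~ is_edge (inl c) (inr y1) u v && ~~ is_edge (inl d) (inr y2) u v -> h v u = h u v.
  by move=> uv /andP [? ?]; rewrite -hs.
have se : forall u : VG, (u == c) || (u == d) = false ->
 forall v : VH, (v == y1) || (v == y2) = false ->
   ~~ is_edge (inl c) (inr y1) (inr v) (inl u) && ~~ is_edge (inl d) (inr y2) (inr v) (inl u).
  by move=> u /norP [/negbTE u1 /negbTE u2] v /norP [v1 v2]; rewrite /is_edge !sumE u1 u2 /= ?andbF.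
have si : forall u v : VH, ~~ is_edge (inl c) (inr y1) (inr v) (inr u) && ~~ is_edge (inl d) (inr y2)
  (inr v) (inr u).
  by move=> u v; rewrite /is_edge !sumE /= ?andbF.
rewrite (s _ _ xa) ?se ?neG ?neH //; rewrite (s _ _ yb) ?se ?neG ?neH //.
rewrite (s _ _ xx1) ?si // (s _ _ yx2) ?si // in hH.
have hxy : h (inr x) (inr y) = h (inr y) (inr x) by rewrite (s _ _ xy).
apply: (@I3_eq (h (inr x) (inr x1)) (h (inr x) (inr y))).
- by apply: hp; rewrite // inr_eqE neH.
- exact: hp.
- exact: hp.
- by rewrite hH; apply: hp.
- by rewrite hxy; apply: hp.
Qed.

Lemma dot_uncolourable :
  ~ three_edge_colourable adjG -> ~ three_edge_colourable adjH -> ~ three_edge_colourable D.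
Proof.
move=> nG nH [h [hs hp]]; apply: (dot_half_edges nG nH (h := h)) => [u v w|u v _ _ _].
  exact: hp.
exact: hs.
Qed.

End DotColour.

(** * Inserting a rung *)

(** Same pattern as [dot_ineq]: the subdivided edges [pq] and [rs] on the left, the bound for the
    old cut and the five new edges on the right; [w] and [z] place the new vertices. *)
Definition rung_ineq nA mA (p q r s w z : bool) :=
  [&& (1 < nA) || (p + q + r + s <= nA), (1 < mA) || (~~ p + ~~ q + ~~ r + ~~ s <= mA),
      1 < nA + w + z & 1 < mA + ~~ w + ~~ z] ==>
  (4 + (p != q) + (r != s)
     <= cut_bound nA mA + (p != w) + (q != w) + (r != z) + (s != z) + (w != z)).

Lemma rung_ineq_check : all_lt3 (fun nA => all_lt3 (fun mA =>
  all_bool (fun p => all_bool (fun q => all_bool (fun r => all_bool (fun s => all_bool (fun w =>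
  all_bool (fun z => rung_ineq nA mA p q r s w z)))))))).
Proof. by vm_compute. Qed.

Section Rung.
Variables (V : finType) (p q r s : V).
Hypothesis u4 : uniq [:: p; q; r; s].
Implicit Types (e : rel V).

(* [inr true] subdivides [pq], [inr false] subdivides [rs]. *)
Definition rung e : rel (V + bool) :=
  add_edge (inr true) (inr false) (add_edge (inl s) (inr false) (add_edge (inl r) (inr false)
  (add_edge (inl q) (inr true) (add_edge (inl p) (inr true)
  (del_edge (inl r) (inl s) (del_edge (inl p) (inl q) (sumrel e (fun _ _ => false)))))))).

Let ne4 := uniq4_neq u4.

Ltac rside := edge_simp; rewrite ?ne4 ?eqxx ?andbF ?orbF ?andbT /=; auto.

Lemma rung_sym e : symmetric e -> symmetric (rung e).
Proof. by move=> es; solve_sym. Qed.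

Lemma rung_irr e : irreflexive e -> irreflexive (rung e).
Proof.
by move=> ei; repeat first [apply: add_edge_irr; first by rewrite ?sumE ?ne4
  | apply: del_edge_irr | apply: sumrel_irr].
Qed.

Lemma rung_ll e u v : rung e (inl u) (inl v) = [&& e u v, ~~ is_edge p q u v & ~~ is_edge r s u v].
Proof. by rewrite /rung /add_edge /del_edge /is_edge !sumE /= ?andbF ?orbF ?andbT -?andbA. Qed.

Lemma rung_lr e u i : rung e (inl u) (inr i) = if i then (u == p) || (u == q) else (u == r) || (u == s).
Proof.
by rewrite /rung /add_edge /del_edge /is_edge !sumE /=; case: i; rewrite ?andbF ?orbF ?andbT //= orbC.
Qed.

Lemma rung_rr e i j : rung e (inr i) (inr j) = (i != j).
Proof. by rewrite /rung /add_edge /del_edge /is_edge !sumE /=; case: i; case: j. Qed.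

Lemma deg_rung e : symmetric e -> e p q -> e r s ->
  (forall u, deg (rung e) (inl u) = deg e u) /\ (forall i, deg (rung e) (inr i) = 3).
Proof.
move=> es epq ers.
have dR z : deg (rung e) z + (z == inl p) + (z == inl q) + (z == inl r) + (z == inl s)
  = deg (sumrel e (fun _ _ : bool => false)) z + (z == inl p) + (z == inl q) + (z == inl r)
   + (z == inl s) + (z == inr true) + (z == inr true) + (z == inr true) + (z == inr false)
   + (z == inr false) + (z == inr false).
  rewrite /rung !deg_add; try solve [solve_sym | rside].
  rewrite (@deg_del _ (inl p) (inl q) (sumrel e _)); try solve [solve_sym | rside].
  rewrite (@deg_del _ (inl r) (inl s) (del_edge (inl p) (inl q) _)); try solve [solve_sym | rside].
  by nat_lia.
split=> u; first by have := dR (inl u); rewrite deg_suml !sumE /=; nat_lia.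
have := dR (inr u); rewrite deg_sumr [X in _ = X + _ + _ + _ + _ + _ + _ + _ + _ + _ + _]degE big1 ?sumE //.
by case: u; rewrite /= ?addn0 ?add0n.
Qed.

Lemma rung_cubic e : cubic e -> e p q -> e r s -> cubic (rung e).
Proof.
move=> [[es ei] e3] epq ers; split; first by split; [exact: rung_sym | exact: rung_irr].
by have [dl dr] := deg_rung es epq ers; case=> v; rewrite ?dl ?dr.
Qed.

Lemma cut_rung e S : symmetric e -> e p q -> e r s ->
  cut_size (rung e) S + ((inl p \in S) != (inl q \in S)) + ((inl r \in S) != (inl s \in S))
  = cut_size e (inl @^-1: S) + ((inl p \in S) != (inr true \in S)) + ((inl q \in S) != (inr true \in S))
   + ((inl r \in S) != (inr false \in S)) + ((inl s \in S) != (inr false \in S))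
   + ((inr true \in S) != (inr false \in S)).
Proof.
move=> es epq ers.
have -> : cut_size e (inl @^-1: S) = cut_size (sumrel e (fun _ _ : bool => false)) S.
  by rewrite cut_sum [X in _ + X]cut_sizeE [X in _ + X]big1 ?addn0 // => i _; rewrite big1.
rewrite /rung !cut_add; try solve [solve_sym | rside].
rewrite (@cut_del _ (inl p) (inl q) (sumrel e _)); try solve [solve_sym | rside].
rewrite (@cut_del _ (inl r) (inl s) (del_edge (inl p) (inl q) _)); try solve [solve_sym | rside].
by nat_lia.
Qed.

Lemma rung_three_edge_cut e : cubic e -> e p q -> e r s ->
  three_edge_cut_trivial e -> three_edge_cut_trivial (rung e).
Proof.
move=> ce epq ers pe S S2 SC2; have es : symmetric e by case: ce => [[]].
have := cut_rung S es epq ers.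
set A := inl @^-1: S.
have mA u : (inl u \in S) = (u \in A) by rewrite inE.
rewrite !mA => cutR.
have cbool (B : {set bool}) : #|B| = (true \in B) + (false \in B).
  by rewrite -sum1_card big_mkcond big_bool.
move: S2 SC2; rewrite !card_sum_set -/A !preimsetC -/A !cbool !inE => S2 SC2.
have cA := card_ge4 A u4; have := card_ge4 (~: A) u4; rewrite !in_setC => cA'.
have lA := cut_size_ge A ce pe.
move: (all_lt3P rung_ineq_check #|A|) => /all_lt3P /(_ #|~: A|).
move=> /all_boolP /(_ (p \in A)) /all_boolP /(_ (q \in A)) /all_boolP /(_ (r \in A)).
move=> /all_boolP /(_ (s \in A)) /all_boolP /(_ (inr true \in S)) /all_boolP /(_ (inr false \in S)).
move=> /implyP; rewrite !cut_bound_min => /(_ _)/wrap [|].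
  by rewrite !leq_minn2 //=; move: S2 SC2; nat_lia.
move: lA cutR; move: (cut_bound _ _).
by move: (cut_size (rung e) S) (cut_size e A); nat_lia.
Qed.

Section Girth.
Variable e : rel V.
Hypotheses (es : symmetric e) (ei : irreflexive e) (epq : e p q) (ers : e r s).
Hypotheses (npr : ~~ e p r) (nps : ~~ e p s) (nqr : ~~ e q r) (nqs : ~~ e q s).
Hypotheses (te : triangle_free e).

Let rung_rl u i : rung e (inr i) (inl u) = rung e (inl u) (inr i).
Proof. exact: rung_sym. Qed.

Let rung_lr_inj i u v : rung e (inl u) (inr i) -> rung e (inl v) (inr i) -> u = v \/
  e u v /\ ~~ rung e (inl u) (inl v).
Proof.
rewrite !rung_lr !rung_ll /is_edge; case: i => /orP [] /eqP -> /orP [] /eqP ->; try (by left); right;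
  rewrite ?epq ?ers ?[e q p]es ?[e s r]es ?epq ?ers ?eqxx ?orbT ?andbF //.
Qed.

Let rung_lr_fun i j u : rung e (inl u) (inr i) -> rung e (inl u) (inr j) -> i = j.
Proof.
rewrite !rung_lr; case: i; case: j => // /orP [] /eqP ->; by rewrite !ne4.
Qed.

Lemma rung_triangle_free : triangle_free (rung e).
Proof.
have llr u v i : rung e (inl u) (inl v) -> rung e (inl u) (inr i) -> rung e (inl v) (inr i) -> False.
  move=> uv ui vi; case: (rung_lr_inj ui vi) => [E|[_ /negP]] //.
  by move: uv; rewrite E rung_irr.
have lrr u i j : rung e (inl u) (inr i) -> rung e (inl u) (inr j) -> rung e (inr i) (inr j) -> False.
  by move=> ui uj; rewrite (rung_lr_fun ui uj) rung_irr.
case=> [u|u] [v|v] [w|w] uv vw wu; rewrite ?rung_rl in uv vw wu.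
- by move: uv vw wu; rewrite !rung_ll => /and3P [? _ _] /and3P [? _ _] /and3P [? _ _];
  apply: (te (u := u) (v := v) (w := w)).
- exact: llr uv wu vw.
- exact: llr wu vw uv.
- exact: lrr uv wu vw.
- exact: llr vw uv wu.
- exact: lrr vw uv wu.
- exact: lrr wu vw uv.
- by move: uv vw wu; rewrite !rung_rr; case: u; case: v; case: w.
Qed.

Hypothesis qe : square_free e.

(** A square with one new vertex and three old ones would contain a path that forms a triangle of
    [e] with [pq] or [rs]. A square through the rung would need an edge between [p], [q] and [r],
    [s], which [npr], [nps], [nqr] and [nqs] forbid. *)
Lemma rung_square_free : square_free (rung e).
Proof.
have lllr u v w i : rung e (inl u) (inl v) -> rung e (inl v) (inl w) ->
    rung e (inl w) (inr i) -> rung e (inl u) (inr i) -> u = w.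
  rewrite !(rung_ll _ _ v) !(rung_ll _ v) => /and3P [uv _ _] /and3P [vw _ _] wi ui.
  by case: (rung_lr_inj wi ui) => [//|[wu _]]; case: (te uv vw wu).
have llrr u v i j : rung e (inl u) (inl v) -> rung e (inl v) (inr i) -> rung e (inr i) (inr j) ->
    rung e (inl u) (inr j) -> False.
  rewrite rung_ll rung_rr !rung_lr => /and3P [uv _ _] vi ij uj; move: vi ij uj uv.
  by case: i; case: j => // /orP [] /eqP -> _ /orP [] /eqP -> /=;
    rewrite 1?es ?(negbTE npr) ?(negbTE nps) ?(negbTE nqr) ?(negbTE nqs) // es ?(negbTE npr) ?(negbTE
      nps) ?(negbTE nqr) ?(negbTE nqs).
have rr i j k : rung e (inr i) (inr j) -> rung e (inr j) (inr k) -> i = k.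
  by rewrite !rung_rr; case: i; case: j; case: k.
case=> [u|u] [v|v] [w|w] [z|z] uv vw wz zu; rewrite ?rung_rl in uv vw wz zu.
- move: uv vw wz zu; rewrite !rung_ll => /and3P [uv _ _] /and3P [vw _ _] /and3P [wz _ _] /and3P [zu _ _].
  by case: (qe uv vw wz zu) => ->; [left|right].
- by left; rewrite (lllr _ _ _ _ uv vw wz zu).
- by right; rewrite (lllr _ _ _ _ zu uv vw wz).
- by case: (llrr _ _ _ _ uv vw wz zu).
- by left; rewrite -(lllr _ _ _ _ wz zu uv vw).
- by right; rewrite (rung_lr_fun uv zu).
- by case: (llrr _ _ _ _ zu uv vw wz).
- by right; rewrite (rung_lr_fun uv zu).
- by right; rewrite -(lllr _ _ _ _ vw wz zu uv).
- by case: (llrr _ _ _ _ vw wz zu uv).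
- by left; rewrite (rung_lr_fun uv vw).
- by left; rewrite (rung_lr_fun uv vw).
- by case: (llrr _ _ _ _ wz zu uv vw).
- by right; rewrite (rung_lr_fun vw wz).
- by left; rewrite (rung_lr_fun zu wz).
- by left; rewrite (rr _ _ _ uv vw).
Qed.
End Girth.

(** Subdivision makes the halves of [pq] and [rs] separate edges, possibly of different colours;
    every other edge keeps a single colour. *)
Lemma rung_half_edges e (col : V + bool -> V + bool -> 'I_3) : symmetric e ->
  (forall u v, col u v = col v u) ->
  (forall u v w, rung e u v -> rung e u w -> v != w -> col u v != col u w) ->
  exists h : V -> V -> 'I_3, (forall u, half_proper e h u) /\
    (forall u v, e u v -> ~~ is_edge p q u v -> ~~ is_edge r s u v -> h u v = h v u).
Proof.
move=> es hs hp.
pose nbr u v : V + bool := if is_edge p q u v then inr true else if is_edge r s u v then inr false else inl v.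
exists (fun u v => col (inl u) (nbr u v)); split=> [u v w uv uw nvw|u v _ n1 n2]; last first.
  by rewrite /nbr -!(is_edgeC _ _ u) (negbTE n1) (negbTE n2) hs.
have nbr_adj z : e u z -> rung e (inl u) (nbr u z).
  rewrite /nbr => uz; case: ifP => [|n1]; first by rewrite rung_lr; case/orP => /andP [-> _]; rewrite ?orbT.
  case: ifP => [|n2]; first by rewrite rung_lr; case/orP => /andP [-> _]; rewrite ?orbT.
  by rewrite rung_ll uz n1 n2.
apply: hp; try exact: nbr_adj.
apply: contraNneq nvw; rewrite /nbr /is_edge.
have [->|] := eqVneq u p; rewrite ?ne4 /= ?orbF.
  by do 2!case: eqP => [->|_] //; case => ->.
have [->|] := eqVneq u q; rewrite ?ne4 /= ?orbF.
  by move=> _; do 2!case: eqP => [->|_] //; case => ->.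
have [->|] := eqVneq u r; rewrite ?ne4 /= ?orbF.
  by move=> _ _; do 2!case: eqP => [->|_] //; case => ->.
have [->|] := eqVneq u s; rewrite ?ne4 /= ?orbF.
  by move=> _ _ _; do 2!case: eqP => [->|_] //; case => ->.
by move=> _ _ _ _ [->].
Qed.

End Rung.

(** * Hists and outer cycles *)

Lemma connect_map (V W : finType) (e : rel V) (e' : rel W) (f : V -> W) :
  (forall u v, e u v -> connect e' (f u) (f v)) ->
  forall u v, connect e u v -> connect e' (f u) (f v).
Proof.
move=> H u v /connectP [p]; elim: p u => [|w p IH] u /= => [_ -> //|/andP [uw pw] E].
by apply: connect_trans (H _ _ uw) _; apply: IH.
Qed.

Section Ops.
Variable V : finType.
Implicit Types (e t : rel V) (p q u v : V).

Lemma not_is_edge t p q u v : symmetric t -> ~~ t p q -> t u v -> ~~ is_edge p q u v.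
Proof.
move=> ts npq uv; apply: contra npq => /orP [] /andP [/eqP E1 /eqP E2]; move: uv; rewrite E1 E2 //.
by rewrite ts.
Qed.

Lemma cotree_sym e t : symmetric e -> symmetric t -> symmetric (cotree e t).
Proof. by move=> es ts u v; rewrite /cotree es ts. Qed.

(** In case (1) graph and tree undergo the same edge operations. This lemma and its version for
    deletions give the cotree of the result without expanding the construction. *)
Lemma cotree_add_same p q e t C : symmetric C -> ~~ C p q -> cotree e t =2 C ->
  cotree (add_edge p q e) (add_edge p q t) =2 C.
Proof.
move=> cs npq H u v; have := H u v; rewrite /cotree /add_edge.
have [uv _|nuv] := boolP (is_edge p q u v); last by rewrite !orbF.
rewrite !orbT /=; apply/esym/negbTE; apply: contraL uv; exact: (not_is_edge cs npq).
Qed.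

Lemma cotree_del_same p q e t C : symmetric C -> ~~ C p q -> cotree e t =2 C ->
  cotree (del_edge p q e) (del_edge p q t) =2 C.
Proof.
move=> cs npq H u v; have := H u v; rewrite /cotree /del_edge.
have [uv _|nuv] := boolP (is_edge p q u v); last by rewrite !andbT.
rewrite !andbF /=; apply/esym/negbTE; apply: contraL uv; exact: (not_is_edge cs npq).
Qed.

Lemma add_edge_sub p q e e' : subrel e e' -> subrel (add_edge p q e) (add_edge p q e').
Proof. by move=> s u v /orP [/s uv|uv]; rewrite /add_edge uv ?orbT. Qed.

Lemma del_edge_sub p q e e' : subrel e e' -> subrel (del_edge p q e) (del_edge p q e').
Proof. by move=> s u v /andP [/s uv n]; rewrite /del_edge uv. Qed.

Lemma sub_del_edge p q e t : symmetric t -> ~~ t p q -> subrel t e -> subrel t (del_edge p q e).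
Proof. by move=> ts npq s u v uv; rewrite /del_edge s //=; exact: (not_is_edge ts npq uv). Qed.

Lemma sub_add_edge p q e t : subrel t e -> subrel t (add_edge p q e).
Proof. by move=> s u v uv; rewrite /add_edge s. Qed.

Lemma hist_intro e t : symmetric t -> irreflexive t -> subrel t e -> (forall u v, connect t u v) ->
  \sum_u deg t u <= (#|V|.-1).*2 -> (forall v, deg t v != 2) -> hist e t.
Proof. by move=> ts ti te tc tn t2; split=> //; split=> //; apply: acyclic_count. Qed.

End Ops.

Section HistFacts.
Variables (V : finType) (adj t : rel V).
Hypotheses (ce : cubic adj) (te : triangle_free adj) (ht : hist adj t).
Implicit Types u v w : V.

Let es : symmetric adj. Proof. by case: ce => [[]]. Qed.
Let ei : irreflexive adj. Proof. by case: ce => [[]]. Qed.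
Let e3 v : deg adj v = 3. Proof. by case: ce. Qed.
Let ts : symmetric t. Proof. by case: ht => [[]]. Qed.
Let tsub : subrel t adj. Proof. by case: ht => [[]]. Qed.
Let tc u v : connect t u v. Proof. by case: ht => [[]]. Qed.

Lemma hist_irr : irreflexive t.
Proof. by move=> v; apply/negbTE; apply/negP => /tsub; rewrite ei. Qed.

Lemma nbrs3_exists v w : adj v w -> exists p q, nbrs3 adj v w p q.
Proof.
move=> vw; pose N := [set z | adj v z].
have : #|N :\ w| == 2.
  have := cardsD1 w N; rewrite inE vw; have -> : #|N| = 3 := e3 v.
  by rewrite add1n => -[<-].
case/cards2P => p [q [pq E]]; exists p, q.
have Ez z : adj v z = (z \in [:: w; p; q]).
  have wN : w \in N by rewrite inE.
  by have /setP /(_ z) := setD1K wN; rewrite E /N !inE => <-.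
have wN : w \notin N :\ w by rewrite !inE eqxx.
split=> //; move: wN; rewrite E !inE negb_or => /andP [wp wq].
by rewrite /= !inE negb_or wp wq pq.
Qed.

Lemma hist_deg v : (deg t v == 1) || (deg t v == 3).
Proof.
have le3 : deg t v <= 3.
  by rewrite -(e3 v); apply/subset_leq_card/subsetP => w; rewrite !inE; apply: tsub.
have n0 : deg t v != 0.
  have : 0 < deg adj v by rewrite e3.
  case/card_gt0P => w; rewrite inE => vw; apply/negP => /eqP/cards0_eq E.
  have : w \in [set v].
    apply: (connect_stable (S := [set v]) ts (set11 v) _ (tc v w)) => p q; rewrite inE => /eqP -> vq.
    by move/setP: E => /(_ q); rewrite !inE vq.
  by rewrite inE => /eqP E'; rewrite E' ei in vw.
have := proj2 ht v; move: le3 n0; by case: (deg t v) => [|[|[|[|n]]]].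
Qed.

Lemma inner_adj v w : deg t v = 3 -> t v w = adj v w.
Proof.
move=> d3; have : [set z | t v z] == [set z | adj v z].
  rewrite eqEcard; apply/andP; split; last by rewrite -/(deg adj v) -/(deg t v) d3 e3.
  by apply/subsetP => z; rewrite !inE; apply: tsub.
by move/eqP/setP => /(_ w); rewrite !inE.
Qed.

Lemma leaf_nbr v : leaf t v -> exists2 w, t v w & forall z, t v z -> z = w.
Proof.
move/cards1P => [w E]; exists w => [|z]; have := congr1 (fun S : {set V} => _ \in S) E.
  by move=> /(_ w); rewrite !inE eqxx.
by move=> /(_ z); rewrite !inE => -> /eqP.
Qed.

(** Two adjacent leaves would form a component of the tree on their own, but [u] has further
    neighbours in [adj]. *)
Lemma leaf_inner u v : leaf t u -> t u v -> deg t v = 3.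
Proof.
move=> lu uv; have /orP [lv|/eqP //] := hist_deg v.
have [u' uu' hu] := leaf_nbr lu; have [v' vv' hv] := leaf_nbr lv.
have [p [q [uq Nu]]] := nbrs3_exists (tsub uv).
have : p \in [set u; v].
  apply: (connect_stable (S := [set u; v]) ts (set21 u v) _ (tc u p)) => y z; rewrite !inE => /orP [] /eqP ->.
    by move=> /hu ->; rewrite (hu _ uv) eqxx orbT.
  by move=> /hv ->; rewrite -(hv u) ?eqxx // ts.
have up : adj u p by rewrite Nu !inE eqxx orbT.
rewrite !inE => /orP [] /eqP E; subst p; first by rewrite ei in up.
by rewrite /= !inE eqxx in uq.
Qed.

(** Otherwise an inner vertex [p] has only leaves as tree neighbours, so [p] and these are all the
    vertices. A neighbour [q] of [p] then has another neighbour [w] that is adjacent to [p] as well: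
    a triangle. *)
Lemma inner_inner v : exists p q, [/\ t p q, deg t p = 3 & deg t q = 3].
Proof.
have [p dp] : exists p, deg t p = 3.
  have /orP [lv|/eqP] := hist_deg v; last by exists v.
  by have [w vw _] := leaf_nbr lv; exists w; apply: leaf_inner vw.
have [/existsP [q /andP [pq /eqP dq]]|H] := boolP [exists q, t p q && (deg t q == 3)].
  by exists p, q.
have lq q : t p q -> leaf t q.
  move=> pq; have /orP [//|dq] := hist_deg q.
  by case/existsP: H; exists q; rewrite pq.
have /card_gt0P [q] : 0 < deg adj p by rewrite e3.
rewrite inE => pq; have [w [z [uw Nq]]] : exists w z, nbrs3 adj q p w z.
  by apply: nbrs3_exists; rewrite es.
have qw : adj q w by rewrite Nq !inE eqxx orbT.
have : w \in p |: [set z | t p z].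
  apply: (connect_stable (S := p |: [set z | t p z]) ts (setU11 p _) _ (tc p w)) => i j; rewrite !inE.
  case/predU1P => [-> -> |pi ij]; first by rewrite orbT.
  have [k _ hk] := leaf_nbr (lq i pi).
  by rewrite (hk j ij) (hk p) ?eqxx // ts.
rewrite !inE => /predU1P [E|pw].
  by subst w; rewrite /= !inE eqxx in uw.
by case: (te pq qw _); rewrite es tsub.
Qed.

Lemma deg_cotree v : deg (cotree adj t) v + deg t v = 3.
Proof.
rewrite -(e3 v) !degE -big_split; apply: eq_bigr => w _ /=; rewrite /cotree.
by have := @tsub v w; case: (t v w); case: (adj v w) => // /(_ isT).
Qed.

Lemma even_cotree v : ~~ odd (deg (cotree adj t) v).
Proof. by have := deg_cotree v; case/orP: (hist_deg v) => /eqP ->; case: (deg _ v) => [|[|[|[|n]]]]. Qed.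

End HistFacts.

(** * Components and multisets of their sizes *)

Notation component e x := [set y | connect e x y].

Lemma perm_enumU (T : finType) (A B : {set T}) : [disjoint A & B] ->
  perm_eq (enum (A :|: B)) (enum A ++ enum B).
Proof.
move=> dAB; apply: uniq_perm; rewrite ?enum_uniq // ?cat_uniq ?enum_uniq /= ?andbT.
  apply/hasPn => z; rewrite !mem_enum => zB; apply/negP => zA.
  by move/pred0P: dAB => /(_ z) /=; rewrite zA zB.
by move=> z; rewrite mem_cat !mem_enum inE.
Qed.

Lemma perm_enum_rem (T : finType) (A : {set T}) x : x \in A ->
  perm_eq (enum A) (x :: enum (A :\ x)).
Proof.
move=> xA; apply: uniq_perm; rewrite /= ?enum_uniq ?mem_enum ?setD11 //.
by move=> z; rewrite inE !mem_enum !inE; case: eqVneq => [->|].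
Qed.

Definition card_seq (T : finType) (A : {set {set T}}) := [seq #|C : {set T}| | C <- enum A].

Lemma card_seq_rem (T : finType) (A : {set {set T}}) C : C \in A ->
  perm_eq (rem #|C| (card_seq A)) (card_seq (A :\ C)).
Proof.
move=> CA; have H : perm_eq (card_seq A) (#|C| :: card_seq (A :\ C)).
  exact: perm_map (perm_enum_rem CA).
rewrite -(perm_cons #|C|) -(permPl (perm_to_rem _)) //.
by rewrite (perm_mem H) inE eqxx.
Qed.

Lemma card_seq_imset (V W : finType) (f : V -> W) (A : {set {set V}}) : injective f ->
  perm_eq (card_seq [set f @: (C : {set _}) | C in A]) (card_seq A).
Proof.
move=> fi; have gi : injective (fun C : {set V} => f @: C) by exact: imset_inj.
have -> : card_seq A = [seq #|D : {set W}| | D <- [seq f @: (C : {set V}) | C <- enum A]].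
  by rewrite -map_comp; apply: eq_map => C /=; rewrite card_imset.
apply: perm_map; apply: uniq_perm; rewrite ?enum_uniq ?map_inj_uniq ?enum_uniq //.
move=> D; rewrite mem_enum; apply/imsetP/mapP => [] [C CA ->]; exists C => //.
  by rewrite mem_enum.
by rewrite mem_enum in CA.
Qed.

(** The two image families are disjoint because [set0] is not in [A]: only the empty set can be an
    image under both maps. *)
Lemma card_seq_union (V W U : finType) (f : V -> U) (g : W -> U) (A : {set {set V}}) (B : {set {set W}}) :
  injective f -> injective g -> (forall v w, f v != g w) -> set0 \notin A ->
  perm_eq (card_seq ([set f @: (C : {set _}) | C in A] :|: [set g @: (C :
    {set _}) | C in B])) (card_seq A ++ card_seq B).
Proof.
move=> fi gi fg A0.
apply: (@perm_trans _ (card_seq [set f @: (C : {set _}) | C in A] ++ card_seq [set g @: (C :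
  {set _}) | C in B])).
  rewrite /card_seq -map_cat; apply/perm_map/perm_enumU.
  apply/pred0P => D /=; apply/negP => /andP [/imsetP [C CA ->] /imsetP [C' C'B E]].
  have [C0|/set0Pn [z zC]] := eqVneq C set0; first by rewrite C0 (negbTE A0) in CA.
  have := imset_f f zC; rewrite E => /imsetP [w _ fz].
  by have := fg z w; rewrite fz eqxx.
by apply: perm_cat; apply: card_seq_imset.
Qed.

Lemma comp_stable (V : finType) (e : rel V) u (S : {set V}) : symmetric e ->
  (forall v w, v \in S -> e v w -> w \in S) -> u \in S ->
  (forall v, v \in S -> connect e u v) -> component e u = S.
Proof.
move=> es cl uS cS; apply/setP => v; rewrite inE; apply/idP/idP => [|/cS //].
exact: connect_stable.
Qed.

(** Both conditions are confined to the component of [u], so that outer cycles untouched by the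
    surgery can be transported although edges change elsewhere. The second makes the image closed
    under [e']. *)
Lemma comp_image (V W : finType) (e : rel V) (e' : rel W) (f : V -> W) u : symmetric e' ->
  (forall v w, connect e u v -> e v w -> connect e' (f v) (f w)) ->
  (forall v w, connect e u v -> e' (f v) w -> exists2 z, w = f z & connect e u z) ->
  component e' (f u) = f @: component e u.
Proof.
move=> es' ee' cl; apply: comp_stable => // [v w /imsetP [z]||v /imsetP [z]].
- by rewrite inE => uz -> /(cl _ _ uz) [z' -> uz']; rewrite imset_f ?inE.
- by rewrite imset_f ?inE.
rewrite inE => uz ->.
have H p : path e u p -> connect e' (f u) (f (last u p)).
  elim/last_ind: p => [//|p z' IH]; rewrite rcons_path last_rcons => /andP [pp lz].
  by apply: connect_trans (IH pp) _; apply: ee' lz; apply/connectP; exists p.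
by case/connectP: uz => p /H + ->.
Qed.

Section OuterCycles.
Variables (V : finType) (adj t : rel V).

Lemma outer_cyclesP C :
  reflect (exists2 u, leaf t u & C = component (cotree adj t) u) (C \in outer_cycles adj t).
Proof.
apply: (iffP imsetP) => [[u]|[u lu ->]]; first by rewrite inE; exists u.
by exists u; rewrite ?inE.
Qed.

Lemma outer_cycles0 : set0 \notin outer_cycles adj t.
Proof.
apply/negP => /outer_cyclesP [u _ /setP /(_ u)].
by rewrite !inE connect0.
Qed.

Lemma ocE : oc adj t = card_seq (outer_cycles adj t).
Proof. by []. Qed.
End OuterCycles.

Section OpA.
Variables (VG VH : finType) (a b : VG) (x y x2 : VH) (eG : rel VG) (eH : rel VH).

Lemma opA_ll u v : opA a b x y x2 eG eH (inl u) (inl v) = eG u v && ~~ is_edge a b u v.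
Proof. by rewrite /opA /add_edge /del_edge /is_edge !sumE /= ?andbF ?orbF ?andbT. Qed.

Lemma opA_lr u v : opA a b x y x2 eG eH (inl u) (inr v) = (u == a) && (v == x) || (u == b) && (v == y).
Proof. by rewrite /opA /add_edge /del_edge /is_edge !sumE /= ?andbF ?orbF ?andbT. Qed.

Lemma opA_rr u v : opA a b x y x2 eG eH (inr u) (inr v) = eH u v && ~~ is_edge x x2 u v || is_edge y x2 u v.
Proof. by rewrite /opA /add_edge /del_edge /is_edge !sumE /= ?andbF ?orbF ?andbT. Qed.

End OpA.

Lemma connect_edge (T : finType) (e : rel T) p q u v : symmetric e ->
  connect e p q -> is_edge p q u v -> connect e u v.
Proof.
by move=> es pq /orP [] /andP [/eqP -> /eqP ->]; rewrite // (sym_connect_sym es).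
Qed.

Lemma sum_nat_eq1 (T : finType) (q : T) : \sum_u ((u == q) : nat) = 1.
Proof. by rewrite -[RHS](sum_pt true q). Qed.

(** * Hists and outer cycles of the two products *)

Section DotHist.
Variables (VG VH : finType) (adjG tG : rel VG) (adjH tH : rel VH).
Variables (a b c d : VG) (x y x1 x2 y1 y2 : VH).
Hypotheses (cG : cubic adjG) (cH : cubic adjH).
Hypotheses (tfH : triangle_free adjH).
Hypotheses (htG : hist adjG tG) (htH : hist adjH tH).
Hypotheses (tab : tG a b) (uG : uniq [:: a; b; c; d]).
Hypotheses (Nx : nbrs3 adjH x y x1 x2) (Ny : nbrs3 adjH y x y1 y2) (txy : tH x y).
Hypothesis dx : deg tH x = 3.

Let eGs : symmetric adjG. Proof. by case: cG => [[]]. Qed.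
Let eHs : symmetric adjH. Proof. by case: cH => [[]]. Qed.
Let tGs : symmetric tG. Proof. by case: htG => [[]]. Qed.
Let tHs : symmetric tH. Proof. by case: htH => [[]]. Qed.
Let tGi : irreflexive tG. Proof. exact: hist_irr cG htG. Qed.
Let tHi : irreflexive tH. Proof. exact: hist_irr cH htH. Qed.
Let tGsub : subrel tG adjG. Proof. by case: htG => [[]]. Qed.
Let tHsub : subrel tH adjH. Proof. by case: htH => [[]]. Qed.
Let tGc u v : connect tG u v. Proof. by case: htG => [[]]. Qed.
Let tHc u v : connect tH u v. Proof. by case: htH => [[]]. Qed.

Let neH := uniq6_neq (dot_uniq cH Nx Ny tfH).
Let neG := uniq4_neq uG.

Let uH5 : uniq [:: x; y; x2; y1; y2].
Proof. exact: (mask_uniq (dot_uniq cH Nx Ny tfH) [:: true; true; false; true; true; true]). Qed.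

Let txx2 : tH x x2.
Proof. by rewrite (inner_adj cH htH) // (proj2 Nx) !inE eqxx !orbT. Qed.
Let nyx2 : ~~ adjH y x2. Proof. exact: dot_nyx2 cH Nx Ny tfH. Qed.
Let ntyx2 : ~~ tH y x2. Proof. by apply: contra nyx2; apply: tHsub. Qed.

Let sumG : \sum_u deg tG u = (#|VG|.-1).*2.
Proof. by case: htG => [[_ _ tc ta] _]; apply: tree_sum. Qed.
Let sumH : \sum_u deg tH u = (#|VH|.-1).*2.
Proof. by case: htH => [[_ _ tc ta] _]; apply: tree_sum. Qed.
Let VG0 : 0 < #|VG|. Proof. by apply/card_gt0P; exists a. Qed.
Let VH0 : 0 < #|VH|. Proof. by apply/card_gt0P; exists x. Qed.

Local Notation A e f := (opA a b x y x2 e f).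
Local Notation D e f := (dotp a b c d x y x2 y1 y2 e f).

Let opA_irr : irreflexive (A tG tH).
Proof.
by case=> u; rewrite ?opA_ll ?opA_rr ?tGi ?tHi //= /is_edge; apply/negP => /orP [] /andP [/eqP -> ];
  rewrite ?neH.
Qed.

Let opA_mono : subrel (A tG tH) (A adjG adjH).
Proof.
by do 3 apply: add_edge_sub; do 2 apply: del_edge_sub; case=> u [] v //=; [apply: tGsub | apply: tHsub].
Qed.

(** Shared by both cases: the walks [a x y b] and [x y x2] replace the lost tree edges [ab] and
    [x x2]. The last condition may use connectedness of the [G] side, because in case (1) the lost
    edges [y y1] and [y y2] are bypassed through [G]. *)
Lemma opA_connected (e : rel (VG + VH)) : symmetric e ->
  (forall u v, tG u v -> ~~ is_edge a b u v -> connect e (inl u) (inl v)) ->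
  connect e (inl a) (inr x) -> connect e (inl b) (inr y) -> connect e (inr y) (inr x2) ->
  connect e (inr x) (inr y) ->
  ((forall u v, connect e (inl u) (inl v)) ->
    forall u v, tH u v -> ~~ is_edge x x2 u v -> connect e (inr u) (inr v)) ->
  forall u v, connect e u v.
Proof.
move=> es eG ax byy yx2 xy eH; have cs := sym_connect_sym es.
have ll u v : connect e (inl u) (inl v).
  apply: (connect_map (e := tG)) (tGc u v) => {}u {}v uv.
  have [uvab|] := boolP (is_edge a b u v); last exact: eG.
  apply: (connect_edge (p := inl a) (q := inl b)) => //.
  by apply: connect_trans ax _; apply: connect_trans xy _; rewrite cs.
have rr u v : connect e (inr u) (inr v).
  apply: (connect_map (e := tH)) (tHc u v) => {}u {}v uv.
  have [uvx|] := boolP (is_edge x x2 u v); last exact: eH.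
  by apply: (connect_edge (p := inr x) (q := inr x2)) => //; apply: connect_trans xy _.
have lr u v : connect e (inl u) (inr v).
  by apply: connect_trans (ll u a) _; apply: connect_trans ax _; apply: rr.
by case=> u [] v; rewrite // cs.
Qed.

Let txy' : A tG tH (inr x) (inr y).
Proof. by rewrite opA_rr txy /is_edge !eqxx ?neH. Qed.

(** * Case (2): merging two outer cycles *)

Section LeafCase.
Hypotheses (ly : leaf tH y) (ncd : ~~ tG c d).

Let nty z : tH y z -> z = x.
Proof. by have [w _ H] := leaf_nbr ly => /H ->; apply/esym/H; rewrite tHs. Qed.

(** As [cd], [y y1] and [y y2] are not tree edges, [opB] need not touch the tree. The degree sum
    exceeds that of the two trees by 2, gained at [y], which rises from degree 1 to 3. *)
Lemma dot_hist : hist (D adjG adjH) (A tG tH).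
Proof.
have ts : symmetric (A tG tH) by exact: opA_sym.
have [dl dr] := deg_opA uG uH5 tGs tHs tab txx2 ntyx2.
apply: hist_intro => //.
- rewrite /dotp /opB; do 2 apply: sub_add_edge.
  have nyz z : (z == x) = false -> (z == y) = false -> (z == x2) = false -> ~~ A tG tH (inr y) (inr z).
    move=> zx zy zx2; rewrite opA_rr /is_edge zx zx2 zy ?neH !andbF !orbF andbT; apply/negP.
    by move=> /nty E; rewrite E eqxx in zx.
  apply: sub_del_edge => //; first by rewrite nyz ?neH.
  apply: sub_del_edge => //; first by rewrite nyz ?neH.
  by apply: sub_del_edge => //; rewrite opA_ll (negbTE ncd).
- apply: opA_connected => // [u v uv nab|||||_ u v uv nx]; apply: connect1 => //.
  + by rewrite opA_ll uv.
  + by rewrite opA_lr !eqxx.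
  + by rewrite opA_lr !eqxx orbT.
  + by rewrite opA_rr /is_edge !eqxx orbT.
  + by rewrite opA_rr uv nx.
- rewrite big_sumType /= (eq_bigr _ (fun u _ => dl u)) (eq_bigr _ (fun u _ => dr u)).
  rewrite big_split /= sumG sumH card_sum.
  have -> : \sum_u (u == y).*2 = 2.
    by rewrite (eq_bigr (fun u => (u == y) + (u == y))) ?big_split ?sum_nat_eq1 // => u _; rewrite addnn.
  by move: VG0 VH0; clear; lia.
case=> v; rewrite ?dl ?dr; first by case: htG.
by have [->|_] := eqVneq v y; [rewrite (eqP ly) | rewrite addn0; case: htH].
Qed.


Local Notation cotG := (cotree adjG tG).
Local Notation cotH := (cotree adjH tH).
Local Notation K := (cotree (D adjG adjH) (A tG tH)).

Let cotGs : symmetric cotG. Proof. exact: cotree_sym. Qed.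
Let cotHs : symmetric cotH. Proof. exact: cotree_sym. Qed.
Let Ks : symmetric K.
Proof. by apply: cotree_sym; [apply/opB_sym/opA_sym | apply: opA_sym]. Qed.

(** [K_ll], [K_lr] and [K_rr] show the splicing: the outer cycles lose the edge [cd] and the vertex
    [y], and [c y1] and [d y2] join the loose ends. *)
Let K_ll u v : K (inl u) (inl v) = cotG u v && ~~ is_edge c d u v.
Proof.
rewrite /cotree dot_ll opA_ll.
have [uv|_] := boolP (is_edge a b u v); last by rewrite /= andbT andbAC.
have tuv : tG u v by case/orP: uv => /andP [/eqP -> /eqP ->]; rewrite // tGs.
by rewrite tuv !andbF.
Qed.

Let K_lr u v : K (inl u) (inr v) = (u == c) && (v == y1) || (u == d) && (v == y2).
Proof.
rewrite /cotree dot_lr opA_lr.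
have [->|] := eqVneq u a; rewrite ?neG /= ?orbF; first by case: (v == x).
have [->|] := eqVneq u b; rewrite ?neG /= ?orbF; first by case: (v == y).
by rewrite andbT.
Qed.

Let K_rr u v : K (inr u) (inr v) = [&& cotH u v, u != y & v != y].
Proof.
rewrite /cotree (dot_rr adjG a b c d cH Nx Ny tfH) opA_rr.
have [uv|nyx] := boolP (is_edge y x2 u v).
  by rewrite !orbT andbF; case/orP: uv => /andP [/eqP -> /eqP ->]; rewrite eqxx ?andbF.
have [uv|nxx] := boolP (is_edge x x2 u v).
  have tuv : tH u v by case/orP: uv => /andP [/eqP -> /eqP ->]; rewrite // tHs.
  by rewrite tuv !andbF.
rewrite !orbF !andbT.
(* All [H]-edges at [y] drop out: [xy] is a tree edge, [y y1] and [y y2] are deleted. *)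
have Hy z : [&& adjH y z, ~~ is_edge y y1 y z & ~~ is_edge y y2 y z] && ~~ tH y z = false.
  have tyz : z == x -> tH y z by move/eqP ->; rewrite tHs.
  rewrite (proj2 Ny) !inE /is_edge !eqxx ?neH /=; move: tyz.
  by case: (z == x); case: (z == y1); case: (z == y2); rewrite ?andbF //; case: (tH y z) => // /(_ isT).
have [->|uy] := eqVneq u y; first by rewrite /= andbF -(Hy v) -!andbA.
have [->|vy] := eqVneq v y.
  by rewrite /= !andbF -[RHS](Hy u) eHs tHs (is_edgeC _ _ u) (is_edgeC _ y2 u) -!andbA.
by rewrite /is_edge (negbTE uy) (negbTE vy) /= !andbF /= !andbT.
Qed.

Hypotheses (lc : leaf tG c) (ecd : cotG c d).

Let cotGi : irreflexive cotG.
Proof. by move=> u; rewrite /cotree; case: cG => [[_ ->]]. Qed.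
Let cotHi : irreflexive cotH.
Proof. by move=> u; rewrite /cotree; case: cH => [[_ ->]]. Qed.
Let evG u : ~~ odd (deg cotG u). Proof. exact: even_cotree. Qed.
Let evH u : ~~ odd (deg cotH u). Proof. exact: even_cotree. Qed.

Let cotH_y z : cotH y z -> z = y1 \/ z = y2.
Proof.
rewrite /cotree (proj2 Ny) !inE => /andP [/or3P [] /eqP ->]; [|by left|by right].
by rewrite tHs txy.
Qed.

Let cotHy1 : cotH y y1.
Proof.
rewrite /cotree (proj2 Ny) !inE eqxx orbT /=; apply/negP => /nty /eqP.
by rewrite neH.
Qed.

Let cotHy2 : cotH y y2.
Proof.
rewrite /cotree (proj2 Ny) !inE eqxx !orbT /=; apply/negP => /nty /eqP.
by rewrite neH.
Qed.

(* Every vertex has even degree in a cotree, so none of its edges is a bridge. *)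
Let K_cd : connect K (inl c) (inl d).
Proof.
have ncd' : c != d by rewrite neG.
apply: (connect_map (e := del_edge c d cotG)) => [u v uv|].
  by apply: connect1; rewrite K_ll.
have dE u := deg_del u ncd' cotGs ecd.
apply: odd_connect => [|||u /negbTE uc /negbTE ud]; first exact: del_edge_sym.
- exact: del_edge_irr.
- by have := evG c; rewrite dE eqxx neG addn0 addn1 /= negbK.
by have := evG u; rewrite dE uc ud !addn0.
Qed.

(** With both cotree edges at [y] deleted, [y1] and [y2] are the only vertices of odd degree. *)
Let K_y1y2 : connect K (inr y1) (inr y2).
Proof.
have n1 : y != y1 by rewrite neH.
have n2 : y != y2 by rewrite neH.
pose e1 := del_edge y y1 cotH.
have e1s : symmetric e1 by exact: del_edge_sym.
have e1y : e1 y y2 by rewrite /e1 /del_edge cotHy2 /is_edge ?neH andbF.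
have dE u : deg cotH u = deg (del_edge y y2 e1) u + (u == y) + (u == y2) + (u == y) + (u == y1).
  by rewrite (deg_del u n1 cotHs cotHy1) (deg_del u n2 e1s e1y).
apply: (connect_map (e := del_edge y y2 e1)) => [u v /andP [/andP [uv n]] n'|].
  apply: connect1; rewrite K_rr uv /=; apply/andP; split.
    apply: contraTneq uv => E; move: n n'; rewrite E /is_edge !eqxx /=.
    by move=> /norP [v1 _] /norP [v2 _]; apply/negP => /cotH_y [] E'; rewrite E' eqxx in v1 v2.
  apply: contraTneq uv => E; move: n n'; rewrite E /is_edge !eqxx !andbT /=.
  by move=> /norP [_ v1] /norP [_ v2]; rewrite cotHs; apply/negP => /cotH_y [] E'; rewrite E' eqxx in v1 v2.
apply: odd_connect => [|||u /negbTE u1 /negbTE u2]; first exact: del_edge_sym.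
- by do 2 apply: del_edge_irr.
- by have := evH y1; rewrite dE eqxx !neH !addn0 addn1 /= negbK.
by have := evH u; rewrite dE u1 u2 !addn0 -addnA addnn oddD odd_double addbF.
Qed.

Let M : {set VG + VH} := inl @: component cotG c :|: inr @: (component cotH y :\ y).

Let in_Ml u : (inl u \in M) = connect cotG c u.
Proof.
rewrite in_setU mem_imset ?inE; last by move=> ? ? [].
by case: (connect cotG c u) => //=; apply/imsetP => [] [].
Qed.

Let in_Mr v : (inr v \in M) = (v != y) && connect cotH y v.
Proof.
rewrite in_setU [X in _ || X]mem_imset ?inE; last by move=> ? ? [].
by case: imsetP => [[] //|].
Qed.

Let comp_M : component K (inl c) = M.
Proof.
have cy1 : connect K (inl c) (inr y1) by apply: connect1; rewrite K_lr !eqxx.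
apply: comp_stable => //.
- case=> u [] v; rewrite ?in_Ml ?in_Mr.
  + by rewrite K_ll => cu /andP [uv _]; apply: connect_trans cu (connect1 uv).
  + rewrite K_lr => _ /orP [] /andP [_ /eqP ->]; rewrite neH /=; apply: connect1;
    [exact: cotHy1 | exact: cotHy2].
  + rewrite Ks K_lr => _ /orP [] /andP [/eqP -> _]; rewrite ?connect0 // connect1 //.
  + rewrite K_rr => /andP [_ yu] /and3P [uv _ ->] /=; apply: connect_trans yu (connect1 uv).
- by rewrite in_Ml connect0.
case=> v; rewrite ?in_Ml ?in_Mr.
  apply: connect_map => {}u {}v uv.
  have [cd|ncd'] := boolP (is_edge c d u v); last by apply: connect1; rewrite K_ll uv.
  by apply: (connect_edge (p := inl c) (q := inl d)).
case/andP => /negbTE vy yv; apply: connect_trans cy1 _.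
(* [y] is isolated in [K], so walks of the old cycle through it are rerouted: [y] is sent to [y1],
   and a step between [y] and [y2] becomes a walk between [y1] and [y2]. *)
pose f w : VG + VH := inr (if w == y then y1 else w).
have := @connect_map _ _ cotH K f _ _ _ yv; rewrite /f eqxx vy; apply=> u w uw.
case: (eqVneq u y) (eqVneq w y) => [E|uy] [E'|wy]; subst => //.
- by case: (cotH_y uw) => ->.
- rewrite cotHs in uw; rewrite (sym_connect_sym Ks).
  by case: (cotH_y uw) => ->.
- by apply: connect1; rewrite K_rr uw uy wy.
Qed.

Let comp_eq (V : finType) (e : rel V) u v : symmetric e -> connect e u v -> component e u = component e v.
Proof.
move=> es uv; apply/setP => w; rewrite !inE; apply: same_connect uv w.
exact: sym_connect_sym.
Qed.

Let comp_l u : ~~ connect cotG c u -> component K (inl u) = inl @: component cotG u.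
Proof.
move=> ncu; have nc v : connect cotG u v -> (v == c) = false /\ (v == d) = false.
  move=> uv; have nv : ~~ connect cotG c v.
    apply: contra ncu => cv; apply: connect_trans cv _.
    by rewrite (sym_connect_sym cotGs).
  by split; apply: contraNF nv => /eqP ->; rewrite ?connect0 // connect1.
apply: comp_image => // v w uv vw.
  by apply: connect1; rewrite K_ll vw /is_edge !(nc _ uv).1 !(nc _ uv).2.
case: w vw => w; last by rewrite K_lr !(nc _ uv).1 !(nc _ uv).2.
rewrite K_ll => /andP [vw _]; exists w => //.
exact: connect_trans uv (connect1 vw).
Qed.

Let comp_r u : ~~ connect cotH y u -> component K (inr u) = inr @: component cotH u.
Proof.
move=> nyu; have ny v : connect cotH u v -> [/\ v != y, v != y1 & v != y2].
  move=> uv; have nv : ~~ connect cotH y v.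
    apply: contra nyu => yv; apply: connect_trans yv _.
    by rewrite (sym_connect_sym cotHs).
  by split; apply: contraNneq nv => ->; rewrite ?connect0 // connect1.
apply: comp_image => // v w uv vw.
  apply: connect1; rewrite K_rr vw; have [-> _ _] := ny _ uv.
  by have [->] := ny w (connect_trans uv (connect1 vw)).
have [vy /negbTE v1 /negbTE v2] := ny _ uv.
case: w vw => w; first by rewrite Ks K_lr v1 v2 !andbF.
rewrite K_rr => /and3P [vw _ _]; exists w => //.
exact: connect_trans uv (connect1 vw).
Qed.

Let leaf_l u : leaf (A tG tH) (inl u) = leaf tG u.
Proof. by rewrite /leaf (deg_opA uG uH5 tGs tHs tab txx2 ntyx2).1. Qed.

Let leaf_r v : leaf (A tG tH) (inr v) = leaf tH v && (v != y).
Proof.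
rewrite /leaf (deg_opA uG uH5 tGs tHs tab txx2 ntyx2).2.
by have [->|_] := eqVneq v y; [rewrite (eqP ly) andbF | rewrite addn0 andbT].
Qed.

Let OG := outer_cycles adjG tG :\ component cotG c.
Let OH := outer_cycles adjH tH :\ component cotH y.

Let outer_dot : outer_cycles (D adjG adjH) (A tG tH) =
  M |: ([set inl @: (C : {set VG}) | C in OG] :|: [set inr @: (C : {set VH}) | C in OH]).
Proof.
apply/setP => C; rewrite !inE; apply/outer_cyclesP/idP => [[[u|u]]|].
- rewrite leaf_l => lu ->; have [cu|ncu] := boolP (connect cotG c u).
    by rewrite -(comp_eq Ks (_ : connect K (inl c) (inl u))) ?comp_M ?eqxx //
      -[connect _ _ _]in_set comp_M in_Ml.
  rewrite comp_l // imset_f ?orbT // !inE; apply/andP; split; last by apply/outer_cyclesP; exists u.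
  by apply: contraNneq ncu => /setP /(_ u); rewrite !inE connect0 => <-.
- rewrite leaf_r => /andP [lu uy] ->; have [yu|nyu] := boolP (connect cotH y u).
    by rewrite -(comp_eq Ks (_ : connect K (inl c) (inr u))) ?comp_M ?eqxx //
      -[connect _ _ _]in_set comp_M in_Mr uy.
  rewrite comp_r // [X in [|| _, _ | X]]imset_f ?orbT // !inE; apply/andP; split;
    last by apply/outer_cyclesP; exists u.
  by apply: contraNneq nyu => /setP /(_ u); rewrite !inE connect0 => <-.
case/or3P => [/eqP ->|/imsetP [C' + ->]|/imsetP [C' + ->]].
- by exists (inl c); rewrite ?leaf_l ?comp_M.
- rewrite !inE => /andP [nC /outer_cyclesP [u lu E]]; exists (inl u); rewrite ?leaf_l // E comp_l //.
  by apply: contra nC => cu; rewrite E (comp_eq cotGs cu).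
rewrite !inE => /andP [nC /outer_cyclesP [u lu E]].
have nyu : ~~ connect cotH y u by apply: contra nC => yu; rewrite E (comp_eq cotHs yu).
exists (inr u); rewrite ?E ?comp_r // leaf_r lu.
by apply: contraNneq nyu => ->; rewrite connect0.
Qed.

Lemma dot_oc : perm_eq (oc (D adjG adjH) (A tG tH))
  ((#|component cotG c| + #|component cotH y| - 1) ::
    (rem #|component cotG c| (oc adjG tG) ++ rem #|component cotH y| (oc adjH tH))).
Proof.
set O := [set inl @: (C : {set VG}) | C in OG] :|: [set inr @: (C : {set VH}) | C in OH].
have MO : M \notin O.
  rewrite inE negb_or; apply/andP; split; apply/negP => /imsetP [C _ E].
    have : inr y1 \in M by rewrite in_Mr neH connect1.
    by rewrite E => /imsetP [].
  have : inl c \in M by rewrite in_Ml connect0.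
  by rewrite E => /imsetP [].
rewrite ocE outer_dot.
have -> : #|component cotG c| + #|component cotH y| - 1 = #|M|.
  rewrite /M cardsU (_ : _ :&: _ = set0); last first.
    by apply/setP => z; rewrite !inE; apply/negP => /andP [/imsetP [? _ ->] /imsetP []].
  rewrite cards0 subn0 !card_imset; try by move=> ? ? [].
  by rewrite (cardsD1 y (component cotH y)) inE connect0 add1n addnS subn1.
apply: (@perm_trans _ (#|M| :: card_seq O)).
  apply: (@perm_map _ _ _ _ (M :: enum O)).
  have := perm_enum_rem (setU11 M O); rewrite setU1K //.
rewrite perm_cons; apply: (perm_trans (card_seq_union (A := OG) (f := inl) OH _ (g := inr) _ _ _)) =>
  //; try by move=> ? ? [].
  by rewrite /OG !inE negb_and outer_cycles0 orbT.
apply: perm_cat; rewrite perm_sym; apply: card_seq_rem; apply/outer_cyclesP.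
  by exists c.
by exists y.
Qed.

End LeafCase.

(** * Case (1): keeping all outer cycles *)

Section InnerCase.
Hypotheses (dy : deg tH y = 3) (tcd : tG c d).

Local Notation R e := (rung (inl c) (inr y1) (inl d) (inr y2) e).
Local Notation cotG := (cotree adjG tG).
Local Notation cotH := (cotree adjH tH).

Let tyy1 : tH y y1.
Proof. by rewrite (inner_adj cH htH) // (proj2 Ny) !inE eqxx !orbT. Qed.
Let tyy2 : tH y y2.
Proof. by rewrite (inner_adj cH htH) // (proj2 Ny) !inE eqxx !orbT. Qed.

Lemma rung_uniq : uniq [:: inl c; inr y1; inl d; inr y2 : VG + VH].
Proof. by rewrite /= !inE !sumE neG neH. Qed.

Let DTs : symmetric (D tG tH). Proof. by apply/opB_sym/opA_sym. Qed.
Let Ts : symmetric (R (D tG tH)). Proof. exact: rung_sym. Qed.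

Let Tsub : subrel (R (D tG tH)) (R (D adjG adjH)).
Proof.
do 5 apply: add_edge_sub; do 2 apply: del_edge_sub; case=> u [] v //=.
do 2 apply: add_edge_sub; do 3 apply: del_edge_sub; exact: opA_mono.
Qed.

Let Ti : irreflexive (R (D tG tH)).
Proof.
have Ri : irreflexive (R (D adjG adjH)).
  by apply: rung_irr; exact: (dot_irr _ _ _ _ cG cH Nx Ny tfH).
by move=> u; apply/negbTE/negP => /Tsub; rewrite Ri.
Qed.

(** The condition on [u] and [v] puts them on the same side, so that the edge is not one of the two
    subdivided ones. *)
Let T_ll u v : D tG tH u v -> (if u is inl _ then if v is inl _ then true else false else
   if v is inl _ then false else true) -> R (D tG tH) (inl u) (inl v).
Proof. by move=> uv; rewrite rung_ll uv /is_edge; case: u uv => u; case: v => v //=; rewrite ?andbF. Qed.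

Let T_connected u v : connect (R (D tG tH)) u v.
Proof.
have cs := sym_connect_sym Ts.
(* Connectedness in the final tree, read as a relation on the old vertices, lets [opA_connected]
   apply although that tree has two more vertices. *)
pose e := [rel u v : VG + VH | connect (R (D tG tH)) (inl u) (inl v)].
have es : symmetric e by move=> p q /=; rewrite cs.
have eT p q : connect e p q -> connect (R (D tG tH)) (inl p) (inl q).
  by apply: (connect_map (e := e)).
have cw : connect (R (D tG tH)) (inl (inl c)) (inr true) by rewrite connect1 // rung_lr !eqxx.
have y1w : connect (R (D tG tH)) (inl (inr y1)) (inr true) by rewrite connect1 // rung_lr !eqxx orbT.
have dz : connect (R (D tG tH)) (inl (inl d)) (inr false) by rewrite connect1 // rung_lr !eqxx.
have y2z : connect (R (D tG tH)) (inl (inr y2)) (inr false) by rewrite connect1 // rung_lr !eqxx orbT.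
have wz : connect (R (D tG tH)) (inr true) (inr false) by rewrite connect1 // rung_rr.
have cy1 : e (inl c) (inr y1) by apply: connect_trans cw _; rewrite cs.
have dy2 : e (inl d) (inr y2) by apply: connect_trans dz _; rewrite cs.
have ll p q : e p q.
  apply: (eT p q); move: p q; apply: opA_connected => // [p q pq nab||||| ec p q pq nx]; apply: connect1.
  (* The lost edge [cd] is bypassed through the second rung. *)
  - have [pqcd|ncd] := boolP (is_edge c d p q).
      apply: (connect_edge (p := inl (inl c)) (q := inl (inl d))) => //.
      by apply: connect_trans cw _; apply: connect_trans wz _; rewrite cs.
    by apply: connect1; apply: T_ll; rewrite // dot_ll pq nab.
  - apply: connect1; rewrite rung_ll dot_lr !eqxx /is_edge /= !sumE !neG !neH /= ?orbT.
    by rewrite ?andbF.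
  - apply: connect1; rewrite rung_ll dot_lr !eqxx /is_edge /= !sumE !neG !neH /= ?orbT.
    by rewrite ?andbF.
  - apply: connect1; apply: T_ll => //.
    by rewrite /dotp /opB /opA /add_edge /del_edge /is_edge !sumE !eqxx ?neH /= ?orbT ?andbF.
  - apply: connect1; apply: T_ll => //.
    by rewrite /dotp /opB /opA /add_edge /del_edge /is_edge !sumE !eqxx ?neH /= txy.
  (* The lost edges [y y1] and [y y2] are bypassed by going to [b], through [G] to [c] or [d], and
     from there along a subdivided edge. *)
  have by_ : e (inr y) (inl b).
    rewrite /= cs; apply: connect1; rewrite rung_ll dot_lr !eqxx /is_edge /= !sumE !neG !neH /= ?orbT.
    by rewrite ?andbF.
  have [pq1|n1] := boolP (is_edge y y1 p q).
    apply: (connect_edge (p := inl (inr y)) (q := inl (inr y1))) => //.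
    by apply: connect_trans by_ _; apply: connect_trans (eT _ _ (ec b c)) _; exact: cy1.
  have [pq2|n2] := boolP (is_edge y y2 p q).
    apply: (connect_edge (p := inl (inr y)) (q := inl (inr y2))) => //.
    by apply: connect_trans by_ _; apply: connect_trans (eT _ _ (ec b d)) _; exact: dy2.
  apply: connect1; apply: T_ll => //; move: n1 n2 nx; rewrite /is_edge.
  rewrite /dotp /opB /opA /add_edge /del_edge /is_edge !sumE /= pq => -> -> ->.
  by rewrite ?andbF ?orbT.
have lr p i : connect (R (D tG tH)) (inl p) (inr i).
  by case: i; [apply: connect_trans (ll p (inl c)) cw | apply: connect_trans (ll p (inl d)) dz].
case: u v => u [v|v]; first exact: ll.
- exact: lr.
- by rewrite cs.
by case: u; case: v; rewrite ?connect0 // cs.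
Qed.

(** Old vertices keep their tree degrees, so the degree sum is that of the two trees plus 6 from the
    new vertices: the right value for a tree with two vertices more than both together. *)
Lemma rung_hist : hist (R (D adjG adjH)) (R (D tG tH)).
Proof.
have [dl dr] := deg_dotp uG uH5 tGs tHs tab tcd txx2 tyy1 tyy2 ntyx2.
have DTcy1 : D tG tH (inl c) (inr y1) by rewrite dot_lr !eqxx !orbT.
have DTdy2 : D tG tH (inl d) (inr y2) by rewrite dot_lr !eqxx !orbT.
have [rl rr] := deg_rung rung_uniq DTs DTcy1 DTdy2.
apply: hist_intro => //.
  rewrite big_sumType /= (eq_bigr _ (fun u _ => rl u)) (eq_bigr _ (fun u _ => rr u)).
  rewrite big_sumType /= (eq_bigr _ (fun u _ => dl u)) (eq_bigr _ (fun u _ => dr u)).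
  rewrite sumG sumH sum_nat_const !card_sum card_bool.
  by move: VG0 VH0; clear; lia.
by case=> [[]|] v; rewrite ?rr // rl ?dl ?dr; [case: htG | case: htH].
Qed.

Let C1 := sumrel cotG cotH.
Let C2 := sumrel C1 (fun _ _ : bool => false).

Let C1s : symmetric C1. Proof. by apply: sumrel_sym; apply: cotree_sym. Qed.
Let C2s : symmetric C2. Proof. exact: sumrel_sym. Qed.

(** All deleted edges are tree edges and all added ones are put into the tree, so the cotree stays
    that of the two graphs side by side. *)
Let cot1 : cotree (D adjG adjH) (D tG tH) =2 C1.
Proof.
have nt p q : tG p q -> ~~ cotG p q by rewrite /cotree => ->; rewrite andbF.
have nt' p q : tH p q -> ~~ cotH p q by rewrite /cotree => ->; rewrite andbF.
do 2 (apply: cotree_add_same => //).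
apply: cotree_del_same => //; first exact: nt'.
apply: cotree_del_same => //; first exact: nt'.
apply: cotree_del_same => //; first exact: nt.
apply: cotree_add_same => //; first by rewrite /= /cotree (negbTE nyx2).
do 2 (apply: cotree_add_same => //).
apply: cotree_del_same => //; first exact: nt'.
apply: cotree_del_same => //; first exact: nt.
by case=> u [] v.
Qed.

Let cot2 : cotree (R (D adjG adjH)) (R (D tG tH)) =2 C2.
Proof.
do 5 (apply: cotree_add_same => //); do 2 (apply: cotree_del_same => //).
by case=> u [] v //=; apply: cot1.
Qed.

Lemma rung_oc : perm_eq (oc (R (D adjG adjH)) (R (D tG tH))) (oc adjG tG ++ oc adjH tH).
Proof.
pose f (u : VG) : VG + VH + bool := inl (inl u).
pose g (u : VH) : VG + VH + bool := inl (inr u).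
have cE u : component (cotree (R (D adjG adjH)) (R (D tG tH))) u = component C2 u.
  by apply/setP => v; rewrite !inE; apply: eq_connect cot2 _ _.
have compf u : component C2 (f u) = f @: component cotG u.
  apply: comp_image => // [v w _ vw|v [[w|w]|w] uv vw //]; first exact: connect1.
  by exists w => //; apply: connect_trans uv _; apply: connect1.
have compg u : component C2 (g u) = g @: component cotH u.
  apply: comp_image => // [v w _ vw|v [[w|w]|w] uv vw //]; first exact: connect1.
  by exists w => //; apply: connect_trans uv _; apply: connect1.
have [dl dr] := deg_dotp uG uH5 tGs tHs tab tcd txx2 tyy1 tyy2 ntyx2.
have DTcy1 : D tG tH (inl c) (inr y1) by rewrite dot_lr !eqxx !orbT.
have DTdy2 : D tG tH (inl d) (inr y2) by rewrite dot_lr !eqxx !orbT.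
have [rl rr] := deg_rung rung_uniq DTs DTcy1 DTdy2.
have lf u : leaf (R (D tG tH)) (f u) = leaf tG u by rewrite /leaf rl dl.
have lg u : leaf (R (D tG tH)) (g u) = leaf tH u by rewrite /leaf rl dr.
have E : outer_cycles (R (D adjG adjH)) (R (D tG tH)) =
   [set f @: (C : {set VG}) | C in outer_cycles adjG tG] :|:
   [set g @: (C : {set VH}) | C in outer_cycles adjH tH].
  apply/setP => C; rewrite in_setU; apply/outer_cyclesP/orP.
    case=> [[[u|u]|i]] lu ->; rewrite cE.
    - by left; rewrite compf imset_f //; apply/outer_cyclesP; exists u; rewrite -?lf.
    - by right; rewrite compg imset_f //; apply/outer_cyclesP; exists u; rewrite -?lg.
    by move: lu; rewrite /leaf rr.
  case=> /imsetP [C' /outer_cyclesP [u lu ->] ->].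
    by exists (f u); rewrite ?lf // cE compf.
  by exists (g u); rewrite ?lg // cE compg.
rewrite ocE E; apply: card_seq_union => //; try by move=> ? ? [].
exact: outer_cycles0.
Qed.

End InnerCase.
End DotHist.

(** * The products are snarks *)

Section SnarkFacts.
Variables (V : finType) (adj : rel V).

Lemma snark_intro : cubic adj -> three_edge_cut_trivial adj -> triangle_free adj ->
  square_free adj -> ~ three_edge_colourable adj -> snark adj.
Proof. by move=> ce pe te qe ne; split=> //; [exact: trivial_cyc4 | exact: girth5]. Qed.

Hypothesis sadj : snark adj.

Lemma snark_triangle_free : triangle_free adj.
Proof. by case: sadj => [[[_ ei] _]] _ g _; apply: girth5_triangle_free. Qed.

Lemma snark_square_free : square_free adj.
Proof. by case: sadj => [[[_ ei] _]] _ g _; apply: girth5_square_free. Qed.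

Lemma snark_three_edge_cut : three_edge_cut_trivial adj.
Proof. by case: sadj => ce c4 _ _; apply: cyc4_trivial. Qed.

(** The empty graph would be 3-edge-colourable. *)
Lemma snark_inhabited : exists v : V, true.
Proof.
case: (pickP (fun _ : V => true)) => [v _|V0]; first by exists v.
case: sadj => _ _ _ []; exists (fun _ _ => ord0); split=> // u.
by have := V0 u.
Qed.

End SnarkFacts.

Lemma oc_memP (V : finType) (adj t : rel V) k : cubic adj -> hist adj t -> k \in oc adj t ->
  exists u v, [/\ leaf t u, cotree adj t u v & k = #|component (cotree adj t) u|].
Proof.
move=> ce ht /mapP [C]; rewrite mem_enum => /outer_cyclesP [u lu ->] ->.
have : 0 < deg (cotree adj t) u by have := deg_cotree ce ht u; rewrite (eqP lu); lia.
by case/card_gt0P => v; rewrite inE => uv; exists u, v.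
Qed.

Section Products.
Variables (VG VH : finType) (adjG tG : rel VG) (adjH tH : rel VH).
Variables (a b c d : VG) (x y x1 x2 y1 y2 : VH).
Hypotheses (sG : snark adjG) (sH : snark adjH).
Hypotheses (eab : adjG a b) (ecd : adjG c d) (uG : uniq [:: a; b; c; d]).
Hypotheses (Nx : nbrs3 adjH x y x1 x2) (Ny : nbrs3 adjH y x y1 y2).

Let cG : cubic adjG. Proof. by case: sG. Qed.
Let cH : cubic adjH. Proof. by case: sH. Qed.
Let nG : ~ three_edge_colourable adjG. Proof. by case: sG. Qed.
Let nH : ~ three_edge_colourable adjH. Proof. by case: sH. Qed.
Let tfG := snark_triangle_free sG.
Let tfH := snark_triangle_free sH.

Local Notation D := (dotp a b c d x y x2 y1 y2 adjG adjH).

Lemma dot_snark : snark D.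
Proof.
apply: snark_intro.
- exact: dot_cubic eab ecd uG Nx Ny tfH.
- exact: dot_three_edge_cut eab ecd uG Nx Ny tfH (snark_three_edge_cut sG) (snark_three_edge_cut sH).
- exact: dot_triangle_free cG cH uG Nx Ny tfG tfH.
- exact: dot_square_free cG cH uG Nx Ny tfH (snark_square_free sG) (snark_square_free sH).
exact: dot_uncolourable cG cH eab ecd uG Nx Ny tfH nG nH.
Qed.

(** [n1] to [n4] keep the second rung from creating a square: [cd] is deleted, [c y2] and [y1 d] are
    not among the crossing edges, and [y1 y2] would form a triangle with [y] in [H]. *)
Lemma rung_snark : snark (rung (inl c) (inr y1) (inl d) (inr y2) D).
Proof.
have u4 := rung_uniq cH tfH uG Nx Ny.
have sD := dot_snark; have [cD _ _ _] := sD.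
have [[Ds Di] _] := cD.
have y12 : ~~ adjH y1 y2.
  apply/negP => y12; apply: (tfH (u := y) (v := y1) (w := y2)) => //.
    by rewrite (proj2 Ny) !inE eqxx orbT.
  by case: cH => [[es _] _]; rewrite es (proj2 Ny) !inE eqxx !orbT.
move: (dot_uniq cH Nx Ny tfH) uG; rewrite /= !inE !negb_or.
move=> /and5P [_ /and4P [_ _ /negbTE yy1 /negbTE yy2] _ _ /andP [/negbTE y1y2 _]].
move=> /and4P [/and3P [_ /negbTE ac /negbTE ad] /andP [/negbTE bc /negbTE bd] /negbTE cd _].
have Dcy1 : D (inl c) (inr y1) by rewrite dot_lr !eqxx !orbT.
have Ddy2 : D (inl d) (inr y2) by rewrite dot_lr !eqxx !orbT.
have n1 : ~~ D (inl c) (inl d) by rewrite dot_ll /is_edge !eqxx !andbF.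
have n2 : ~~ D (inl c) (inr y2).
  by rewrite dot_lr [c == a]eq_sym [c == b]eq_sym ac bc cd [y2 == y1]eq_sym y1y2 andbF.
have n3 : ~~ D (inr y1) (inl d).
  by rewrite Ds dot_lr [d == a]eq_sym [d == b]eq_sym [d == c]eq_sym ad bd cd y1y2 andbF.
have n4 : ~~ D (inr y1) (inr y2).
  by rewrite (dot_rr adjG a b c d cH Nx Ny tfH) (negbTE y12) /is_edge [y1 == y]eq_sym [y2 == y]eq_sym
    yy1 yy2 /= andbF.
have tfD := snark_triangle_free sD; have qD := snark_square_free sD.
apply: snark_intro.
- exact: rung_cubic.
- exact: rung_three_edge_cut (snark_three_edge_cut sD).
- exact: rung_triangle_free.
- exact: rung_square_free.
(* The halves of [c y1] and [d y2] may differ in colour, so [col] yields no colouring of [D]; the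
   half-edge version still applies. *)
case=> col [hs hp]; have [h [hph hsh]] := rung_half_edges u4 Ds hs hp.
by apply: (dot_half_edges cG cH eab ecd uG Nx Ny tfH nG nH hph).
Qed.

End Products.

Theorem theorem2
  (VG : finType) (adjG tG : rel VG) (VH : finType) (adjH tH : rel VH) :
  snark adjG -> hist adjG tG -> snark adjH -> hist adjH tH ->
  (exists (V' : finType) (adj' t' : rel V'),
      [/\ snark adj', hist adj' t' & perm_eq (oc adj' t') (oc adjG tG ++ oc adjH tH)])
  /\
  (forall k l, k \in oc adjG tG -> l \in oc adjH tH ->
    exists (V' : finType) (adj' t' : rel V'),
      [/\ snark adj', hist adj' t' &
          perm_eq (oc adj' t')
                  ((k + l - 1) :: (rem k (oc adjG tG) ++ rem l (oc adjH tH)))]).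
Proof.
move=> sG htG sH htH.
have [cG _ _ _] := sG; have [cH _ _ _] := sH.
have [[eGs eGi] _] := cG; have [[eHs eHi] _] := cH.
have tfG := snark_triangle_free sG; have tfH := snark_triangle_free sH.
have [[tGs tGsub _ _] _] := htG; have [[tHs tHsub _ _] _] := htH.
split=> [|k l kO lO].
  have [vG _] := snark_inhabited sG; have [vH _] := snark_inhabited sH.
  have [p [q [tpq dp dq]]] := inner_inner cG tfG htG vG.
  have [x [y [txy dx dy]]] := inner_inner cH tfH htH vH.
  have epq := tGsub _ _ tpq; have exy := tHsub _ _ txy.
  have eqp : adjG q p by rewrite eGs.
  have eyx : adjH y x by rewrite eHs.
  have [p1 [p2 Np]] := nbrs3_exists cG epq; have [q1 [q2 Nq]] := nbrs3_exists cG eqp.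
  have [x1 [x2 Nx]] := nbrs3_exists cH exy; have [y1 [y2 Ny]] := nbrs3_exists cH eyx.
  (* All edges at inner vertices are tree edges, so [p p1] and [q q1] can serve as [ab] and [cd];
     [dot_uniq], applied inside [G] to the edge [pq], makes them independent. *)
  have tpp1 : tG p p1 by rewrite (inner_adj cG htG) // (proj2 Np) !inE eqxx orbT.
  have tqq1 : tG q q1 by rewrite (inner_adj cG htG) // (proj2 Nq) !inE eqxx orbT.
  have uG : uniq [:: p; p1; q; q1].
    have := dot_uniq cG Np Nq tfG; rewrite /= !inE !negb_or.
    move=> /and5P [/and5P [-> -> _ -> _] /and4P [qp1 _ -> _] /and3P [_ -> _] _ _].
    by rewrite eq_sym qp1.
  exists (VG + VH + bool)%type, (rung (inl q) (inr y1) (inl q1) (inr y2)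
    (dotp p p1 q q1 x y x2 y1 y2 adjG adjH)), (rung (inl q) (inr y1) (inl q1) (inr y2)
    (dotp p p1 q q1 x y x2 y1 y2 tG tH)); split.
  - exact: (rung_snark sG sH (tGsub _ _ tpp1) (tGsub _ _ tqq1) uG Nx Ny).
  - exact: (rung_hist cG cH tfH htG htH tpp1 uG Nx Ny txy dx dy tqq1).
  exact: (rung_oc cG cH tfH htG htH tpp1 uG Nx Ny dx dy tqq1).
have [c [d [lc cd ->]]] := oc_memP cG htG kO.
have [y [y' [ly _ ->]]] := oc_memP cH htH lO.
(* The tree neighbour [p] of the leaf [c] is inner, so a further edge [pq] is a tree edge and serves
   as [ab]. In [H] the tree neighbour of [y] serves as [x]. *)
have [p tcp hc] := leaf_nbr lc; have [x tyx _] := leaf_nbr ly.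
have dp := leaf_inner cG htG lc tcp; have dx := leaf_inner cH htH ly tyx.
have txy : tH x y by rewrite tHs.
have tpc : tG p c by rewrite tGs.
have [q [q' Np]] := nbrs3_exists cG (tGsub _ _ tpc).
have [x1 [x2 Nx]] := nbrs3_exists cH (tHsub _ _ txy).
have [y1 [y2 Ny]] := nbrs3_exists cH (tHsub _ _ tyx).
have tpq : tG p q by rewrite (inner_adj cG htG) // (proj2 Np) !inE eqxx orbT.
have [ecd ntcd] := andP cd.
have ne u v : adjG u v -> u != v by move=> uv; apply: contraTneq uv => ->; rewrite eGi.
(* [p] differs from [d] because [pc] is a tree edge and [cd] is not; [q = d] would close the
   triangle [c d p]. *)
have uG : uniq [:: p; q; c; d].
  rewrite /= !inE !negb_or (ne _ _ (tGsub _ _ tpq)) (ne _ _ (tGsub _ _ tpc)) (ne _ _ ecd) /= !andbT.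
  apply/and3P; split.
  - by apply: contraNneq ntcd => <-.
  - by case: Np => + _; rewrite /= !inE negb_or eq_sym => /andP [/andP [-> _] _].
  apply/eqP => E; apply: (tfG c d p) => //; last exact: tGsub.
  by rewrite -E eGs; apply: tGsub.
exists (VG + VH)%type, (dotp p q c d x y x2 y1 y2 adjG adjH), (opA p q x y x2 tG tH); split.
- exact: (dot_snark sG sH (tGsub _ _ tpq) ecd uG Nx Ny).
- exact: (dot_hist cG cH tfH htG htH tpq uG Nx Ny txy dx ly ntcd).
exact: (dot_oc cG cH tfH htG htH tpq uG Nx Ny txy dx ly lc cd).
Qed.
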